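(* Let $V$ be a finite-dimensional Euclidean space (real inner product space) and let $\Omega$ be a collection of affine hyperplanes in $V$, consisting of finitely many families of parallel hyperplanes, such that the group $\mathrm{Isom}(V,\Omega)$ of isometries of $V$ preserving $\Omega$ acts properly discontinuously and cocompactly on $V$ and acts on $\Omega$ with finitely many orbits. Let $\Delta$ be the tessellation of $V$ cut out by $\Omega$. For $0\le r\le\dim(V)$ let $G_r$, $C_r$, $C_r^+\le PI(\Delta)$ be as defined in the context. Then there is a chain of normal subgroups of $PI(\Delta)$ $$\{1\}=C_0^+\le C_0\le G_0\le C_1^+\le\cdots\le C_{\dim(V)}\le G_{\dim(V)}=PI(\Delta),$$ where each quotient $G_r/C_r$ or $C_r/C_r^+$ is locally finite and each quotient $C_r^+/G_{r-1}$ is abelian.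
   Context: $\mathrm{Isom}(\Delta)=\mathrm{Isom}(V,\Omega)$. Groups act on the right. A convex polyhedral set is a subset $P\subseteq V$ that is either empty, or has nonempty interior and is the intersection of finitely many closed half-spaces bounded by hyperplanes in $\Omega$ ($V$ itself is allowed). The essential intersection $P\Cap Q$ of convex polyhedral sets is $P\cap Q$ if this has nonempty interior and $\emptyset$ otherwise; $P,Q$ are essentially disjoint if $P\Cap Q=\emptyset$. A finite decomposition of $X\subseteq V$ is a finite collection of pairwise essentially disjoint convex polyhedral sets with union $X$. $PI(\Delta)$ is the group, under composition, of all bijections $f:V\to V$ for which $V$ admits a finite decomposition $P_1,\dots,P_n$ such that the restriction of $f$ to the interior of each $P_i$ extends to an element of $\mathrm{Isom}(\Delta)$. We say $f$ is isometric on a convex polyhedral set $P$ if the restriction of $f$ to the interior of $P$ extends to some $g\in\mathrm{Isom}(\Delta)$; then $Pf$ denotes the convex polyhedral set $Pg$, and the differential of $f$ on $P$ is the linear part of $g$. The limit set $L(C)$ of a convex set $C$ is the set of unit vectors $u$ such that $C$ contains a ray in direction $u$. The rank $\mathrm{rk}(C)$ is the maximal number of linearly independent rays in $C$ (one more than the dimension of $L(C)$), and $\mathrm{rk}(\emptyset)=-1$. A convex polyhedral set $P$ is irreducible if in every finite decomposition of $P$ exactly one member has rank equal to $\mathrm{rk}(P)$. Nonempty irreducible convex polyhedral sets $P,Q$ are commensurable if $P\Cap Q\ne\emptyset$ and $L(P)=L(Q)$; this is an equivalence relation, whose classes $[P]$ are called germs. $\Gamma^r$ is the set of germs of irreducible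 sets of rank $r$. $PI(\Delta)$ acts on germs preserving rank: for a germ $\gamma$ and $f\in PI(\Delta)$, choose a representative $P$ of $\gamma$ on which $f$ is isometric and put $\gamma f_*:=[Pf]$. The support $\mathrm{supp}(f)$ of $f\in PI(\Delta)$ is the union of all convex polyhedral sets $P$ such that $f$ restricts to a nontrivial isometry on the interior of $P$; the rank $\mathrm{rk}(f)$ is the greatest rank of a convex polyhedral set $P\subset\mathrm{supp}(f)$. For $r=0,1,\dots,\dim(V)$ define $$G_r=\{f\in PI(\Delta):\mathrm{rk}(f)\le r\},\qquad C_r=\{f\in PI(\Delta):\gamma f_*=\gamma\ \text{for all }\gamma\in\Gamma^r\},$$ and let $C_r^+\le C_r$ be the subgroup of those $f\in C_r$ such that for every $\gamma\in\Gamma^r$ the differential of $f$ on a representative of $\gamma$ on which $f$ is isometric is the identity (this does not depend on the representative).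
   Formalization: Ω is assumed locally finite; PI(Δ) consists of the f with both f and its inverse piecewise isometric; {1} means the elements of PI(Δ) that are the identity on the interiors of a finite decomposition; C_r is the set of f in G_r (not all of PI(Δ)) fixing Γ^r, and C_r^+ is its subgroup. *)

(* Defs.v *)
From HB Require Import structures.
From mathcomp Require Import all_boot all_order all_algebra.
From mathcomp Require Import all_classical all_reals all_analysis.

Set Implicit Arguments.
Unset Strict Implicit.
Unset Printing Implicit Defensive.

Import Order.TTheory GRing.Theory Num.Theory.
Import numFieldNormedType.Exports.

Local Open Scope classical_set_scope.
Local Open Scope ring_scope.

(* The group of all bijections of T.  Groups act on the right: f * g is
   "first f, then g". *)
Record bijection (T : Type) := Bijection {
  bij_fun :> T -> T;
  bij_inv : T -> T;
  bij_funK : cancel bij_fun bij_inv;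
  bij_invK : cancel bij_inv bij_fun
}.

HB.instance Definition _ (T : Type) := gen_eqMixin (bijection T).
HB.instance Definition _ (T : Type) := gen_choiceMixin (bijection T).

Section BijGroup.
Variable T : Type.
Implicit Types f g h : bijection T.

Lemma bijP f g : f =1 g -> f = g.
Proof.
case: f => f f' fK f'K; case: g => g g' gK g'K /= fg.
have efg : f = g by apply: funext.
subst g.
have ef'g' : f' = g' by apply: funext => x; rewrite -[in LHS](g'K x) fK.
subst g'.
by rewrite (Prop_irrelevance gK fK) (Prop_irrelevance g'K f'K).
Qed.

Definition bij1 : bijection T := @Bijection T id id (fun=> erefl) (fun=> erefl).

Definition bijV f : bijection T := Bijection (@bij_invK T f) (@bij_funK T f).

Definition bijM f g : bijection T :=
  Bijection (can_comp (@bij_funK T g) (@bij_funK T f))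
      (can_comp (@bij_invK T f) (@bij_invK T g)).

Lemma bijMA : associative bijM. Proof. by move=> f g h; apply: bijP. Qed.
Lemma bij1M : left_id bij1 bijM. Proof. by move=> f; apply: bijP. Qed.
Lemma bijM1 : right_id bij1 bijM. Proof. by move=> f; apply: bijP. Qed.
Lemma bijVM : left_inverse bij1 bijV bijM.
Proof. by move=> f; apply: bijP => x /=; rewrite bij_invK. Qed.
Lemma bijMV : right_inverse bij1 bijV bijM.
Proof. by move=> f; apply: bijP => x /=; rewrite bij_funK. Qed.

End BijGroup.

HB.instance Definition _ (T : Type) := isGroup.Build (bijection T)
  (@bijMA T) (@bij1M T) (@bijM1 T) (@bijVM T) (@bijMV T).

Section GroupTheory.
Variable gT : groupType.
Implicit Types (G H N S : set gT) (x y : gT).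

Definition subgroup G :=
  G 1%g /\ (forall x y, G x -> G y -> G (x / y)%g).

Definition normal_subgroup N G :=
  [/\ subgroup N, N `<=` G & forall x y, N x -> G y -> N (x ^ y)%g].

Definition generated_subgroup S : set gT := smallest subgroup S.

Definition coset_by N x : set gT := [set (x * y)%g | y in N].

(* Every finitely generated subgroup of G / N is finite: the subgroup of G / N
   generated by the cosets of the elements of S is the image of <S>. *)
Definition locally_finite_quotient G N :=
  forall S, finite_set S -> S `<=` G ->
    finite_set [set coset_by N x | x in generated_subgroup S].

Definition abelian_quotient G N :=
  forall x y, G x -> G y -> coset_by N (x * y)%g = coset_by N (y * x)%g.

End GroupTheory.

(* The greatest element of a set of integers, when there is one. *)
Definition greatest (A : set int) : int :=
  xget (- 1) [set m | A m /\ forall k, A k -> k <= m].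

Section EuclideanSpace.
Variables (R : realType) (n : nat).
Local Notation V := 'rV[R]_n.
Implicit Types (C P Q X : set V) (u v x y : V).

Definition dot u v : R := \sum_(i < n) u ord0 i * v ord0 i.

(* The norm `|v| that MathComp-Analysis puts on 'rV[R]_n is the sup norm; it
   induces the usual topology but is not the Euclidean norm. *)
Definition enorm v : R := Num.sqrt (dot v v).

Definition euclidean_isometry (g : bijection V) :=
  forall x y, enorm (g x - g y) = enorm (x - y).

Definition linear_part (g : bijection V) : V -> V := fun v => g v - g 0.

Definition hyperplane (a : V) (b : R) : set V := [set x | dot a x = b].

Definition parallel_family (A : set (set V)) :=
  exists2 a : V, a != 0 & forall H, A H -> exists b, H = hyperplane a b.

Definition ray x u : set V := [set x + t *: u | t in [set t : R | 0 <= t]].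

Definition limit_set C : set V :=
  [set u | enorm u = 1 /\ exists x, ray x u `<=` C].

Definition rk C : int :=
  if `[< C = set0 >] then - 1 else
  greatest [set k%:Z | k in [set k : nat | exists M : 'M[R]_(k, n),
    row_free M /\ forall i, limit_set C (row i M)]].

Definition ess_inter P Q : set V :=
  if `[< (P `&` Q)° !=set0 >] then P `&` Q else set0.

Definition ess_disjoint P Q := ess_inter P Q = set0.

End EuclideanSpace.

Section Arrangement.
Variables (R : realType) (n : nat).
Local Notation V := 'rV[R]_n.
Variable Omega : set (set V).
Implicit Types (C P Q X : set V) (f g : bijection V) (gamma : set (set V)).

Definition finitely_many_parallel_families :=
  exists F : set (set (set V)), [/\ finite_set F,
    forall A, F A -> parallel_family A & Omega = \bigcup_(A in F) A].

(* Omega cuts V into a tessellation. *)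
Definition locally_finite_arrangement :=
  forall x : V, exists2 U, nbhs x U &
    finite_set [set H | Omega H /\ H `&` U !=set0].

Definition Isom : set (bijection V) :=
  [set g | euclidean_isometry g /\ [set g @` H | H in Omega] = Omega].

Definition Isom_properly_discontinuous :=
  forall K : set V, compact K ->
    finite_set [set g | Isom g /\ (g @` K) `&` K !=set0].

Definition Isom_cocompact :=
  exists2 K : set V, compact K & \bigcup_(g in Isom) (g @` K) = setT.

Definition Isom_finitely_many_orbits :=
  finite_set [set [set g @` H | g in Isom] | H in Omega].

(* Both half-spaces bounded by a hyperplane arise, from (a, b) and (- a, - b). *)
Definition halfspace (h : set V) := exists (a : V) (b : R),
  [/\ a != 0, Omega (hyperplane a b) & h = [set x | b <= dot a x]].

Definition polyhedral P := P = set0 \/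
  P° !=set0 /\ exists F : set (set V), [/\ finite_set F,
    forall h, F h -> halfspace h & P = \bigcap_(h in F) h].

Definition decomposition (D : set (set V)) X :=
  [/\ finite_set D,
      forall P, D P -> polyhedral P,
      forall P Q, D P -> D Q -> P <> Q -> ess_disjoint P Q &
      \bigcup_(P in D) P = X].

Definition isometric_by f P g := Isom g /\ forall x, P° x -> f x = g x.

Definition piecewise_isometric f := exists2 D, decomposition D setT &
  forall P, D P -> exists g, isometric_by f P g.

(* The inverse of a piecewise isometric bijection need not be piecewise
   isometric, because nothing is required on the boundaries of the pieces: if
   Omega consists of the lines x = k and y = k of the plane, k an integer,
   shift the open right half-plane by (1, 0), fix the open left half-plane, and
   send the line x = 0 bijectively onto the strip 0 <= x <= 1.  So membership
   of the inverse has to be part of the definition of the group. *)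
Definition PI : set (bijection V) :=
  [set f | piecewise_isometric f /\ piecewise_isometric f^-1%g].

(* Agreement off the boundaries of the pieces.  In PI, bijections that agree
   off the boundaries are one and the same element (any two points could
   otherwise be exchanged if they lie on hyperplanes of Omega); the subgroups
   defined below are unions of classes, and the trivial subgroup is the class
   of the identity. *)
Definition ess_eq f g := exists2 D, decomposition D setT &
  forall P, D P -> forall x, P° x -> f x = g x.

Definition PI_trivial : set (bijection V) := [set f | PI f /\ ess_eq f 1%g].

Definition irreducible P := polyhedral P /\
  forall D, decomposition D P -> exists! Q, D Q /\ rk Q = rk P.

Definition commensurable P Q := ess_inter P Q !=set0 /\ limit_set P = limit_set Q.

Definition germ P : set (set V) :=
  [set Q | [/\ Q !=set0, irreducible Q & commensurable P Q]].

Definition germs (r : nat) : set (set (set V)) :=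
  [set germ P | P in [set P | irreducible P /\ rk P = r%:Z]].

(* [P f] does not depend on the representative P of gamma; the union is taken
   over all representatives on which f is isometric. *)
Definition germ_act gamma f : set (set V) :=
  [set Q | exists P g, [/\ gamma P, isometric_by f P g & germ (g @` P) Q]].

Definition supp f : set V :=
  \bigcup_(P in [set P | polyhedral P /\
                   exists g, isometric_by f P g /\ g <> 1%g]) P.

Definition rk_map f : int :=
  greatest [set rk P | P in [set P | polyhedral P /\ P `<=` supp f]].

Definition G_ (r : nat) : set (bijection V) := [set f | PI f /\ rk_map f <= r%:Z].

(* The action on the germs of rank r is that of G_ r: an element of PI that
   fixes all germs of rank r can have rank bigger than r.  With the
   lines x = k and y = k of the plane, the map that is (x, y) |-> (1 - x, y) on
   [0, 1] x [0, +oo) and the identity elsewhere fixes all germs of rank 0. *)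
Definition C_ (r : nat) : set (bijection V) :=
  [set f | G_ r f /\ forall gamma, germs r gamma -> germ_act gamma f = gamma].

Definition Cplus_ (r : nat) : set (bijection V) :=
  [set f | C_ r f /\ forall gamma, germs r gamma ->
    forall P g, gamma P -> isometric_by f P g -> linear_part g = id].

End Arrangement.

(* Main.v *)
Require Import Defs.
From mathcomp Require Import all_boot all_order all_algebra.
From mathcomp Require Import all_classical all_reals all_analysis.
From mathcomp Require Import ring lra.

Set Implicit Arguments.
Unset Strict Implicit.
Unset Printing Implicit Defensive.

Import Order.TTheory GRing.Theory Num.Theory.
Import numFieldNormedType.Exports.

Local Open Scope classical_set_scope.

(* A nonempty convex polyhedral set is described by a finite list of affine
   forms required to be nonnegative; its interior and its recession cone are read
   off the list.  Following a generic ray of a polyhedral set P, one ends up in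
   the interior of a single member of any finite cover of P, and that member has
   the rank of P.  Hence every germ has a representative on which a given f in
   PI is isometric, and f has a well-defined germ in Isom at every germ of
   polyhedral sets; this is a cocycle, through which G_r, C_r and C_r^+ are
   defined by conditions that make them normal.  By Farkas' lemma finitely many
   walls cut P into irreducible pieces and pieces of lower rank, so that an
   element of G_r moves only finitely many germs of rank r; with the finiteness
   of the set of linear parts of Isom this gives the locally finite quotients.
   Elements of C_r^+ act on each germ of rank r by a translation, and
   translations commute. *)

(** Irreducibility quantifies over all decompositions; [irr] replaces this by a test on one wall at
    a time. A wall that properly cuts an irreducible set has a fixed sign on the recession cone and
    does not vanish there, so a push along the cone carries every point of the set to one fixed side
    of it. This is why two full-rank pieces always overlap, and why commensurability is transitive.
    Dimensions are hardly ever counted: for nested sets equal rank means equal annihilator of the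
    recession cone ([perp]), and annihilators are compared by perturbing a relatively interior
    direction of the cone. An element of PI is uncontrolled on the boundaries of its pieces, so
    identities between maps are checked on the strict solution sets [spoly]. Local finiteness of
    [Omega] bounds the number of parallel walls crossing a set on which their normal is bounded.
    Proper discontinuity makes the normals span, so that a linear part is determined by its effect
    on finitely many unit normals. The bottom of the chain holds because an irreducible set of rank
    0 has trivial recession cone, hence is preserved by no nontrivial translation. *)

(** * The Euclidean inner product *)

Section DotProduct.
Local Open Scope ring_scope.
Context {R : realType} {n : nat}.
Implicit Types (u v w a x y : 'rV[R]_n) (c t : R).

Lemma dotC u v : dot u v = dot v u.
Proof. by apply: eq_bigr => i _; rewrite mulrC. Qed.

Lemma dotDr u v w : dot u (v + w) = dot u v + dot u w.
Proof. by rewrite -big_split; apply: eq_bigr => i _; rewrite mxE mulrDr. Qed.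

Lemma dotZr c u v : dot u (c *: v) = c * dot u v.
Proof. by rewrite mulr_sumr; apply: eq_bigr => i _; rewrite mxE mulrCA. Qed.

Lemma dotDl u v w : dot (u + v) w = dot u w + dot v w.
Proof. by rewrite dotC dotDr !(dotC w). Qed.

Lemma dotZl c u v : dot (c *: u) v = c * dot u v.
Proof. by rewrite dotC dotZr dotC. Qed.

Lemma dotNr u v : dot u (- v) = - dot u v.
Proof. by rewrite -scaleN1r dotZr mulN1r. Qed.

Lemma dotNl u v : dot (- u) v = - dot u v.
Proof. by rewrite dotC dotNr dotC. Qed.

Lemma dot0r u : dot u 0 = 0.
Proof. by rewrite -(scale0r 0) dotZr mul0r. Qed.

Lemma dot0l u : dot 0 u = 0.
Proof. by rewrite dotC dot0r. Qed.

Lemma dot_ge0 u : 0 <= dot u u.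
Proof. by apply: sumr_ge0 => i _; rewrite -expr2 sqr_ge0. Qed.

Lemma dot_eq0 u : (dot u u == 0) = (u == 0).
Proof.
apply/eqP/eqP => [/eqP|->]; last by rewrite dot0r.
rewrite psumr_eq0 => [/allP u0|i _]; last by rewrite -expr2 sqr_ge0.
apply/rowP => i; rewrite mxE; apply/eqP.
by have := u0 i (mem_index_enum i); rewrite mulf_eq0 orbb.
Qed.

Lemma dot_gt0 u : u != 0 -> 0 < dot u u.
Proof. by move=> u0; rewrite lt_def dot_eq0 u0 dot_ge0. Qed.

Lemma dot_nondeg u : (forall v, dot v u = 0) -> u = 0.
Proof. by move=> u0; apply/eqP; rewrite -dot_eq0 u0. Qed.

End DotProduct.

(** * Eventual statements near 0 and near infinity *)

Section NearFilters.
Local Open Scope ring_scope.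
Context {R : realType}.

Lemma near_seq (T : eqType) (U : Type) (F : set_system U) {FF : Filter F}
    (s : seq T) (Q : T -> U -> Prop) :
  (forall p, p \in s -> \forall t \near F, Q p t) ->
  \forall t \near F, forall p, p \in s -> Q p t.
Proof.
elim: s => [_|p s IH sQ]; first by near=> t.
have Qp : \forall t \near F, Q p t by apply: sQ; rewrite mem_head.
have Qs : \forall t \near F, forall q, q \in s -> Q q t.
  by apply: IH => q qs; apply: sQ; rewrite inE qs orbT.
near=> t => q; rewrite inE => /orP[/eqP ->|qs]; first by near: t.
by move: q qs; near: t.
Unshelve. all: by end_near. Qed.

Lemma near_ex2 (U : Type) (F : set_system U) {FF : ProperFilter F}
    (P Q : U -> Prop) :
  (\forall t \near F, P t) -> (\forall t \near F, Q t) ->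
  exists t, P t /\ Q t.
Proof.
by move=> FP FQ; apply: (@filter_ex _ F); near do split.
Unshelve. all: by end_near. Qed.

Lemma near0_affine_gt0 (p q : R) : 0 < p -> \forall t \near 0^'+, 0 < p + t * q.
Proof.
move=> p0; near=> t.
have t0 : 0 < t by near: t; exact: nbhs_right_gt.
have q1 : 0 < `|q| + 1 by rewrite ltr_wpDl.
have : t < p / (`|q| + 1) by near: t; apply: nbhs_right_lt; rewrite divr_gt0.
rewrite ltr_pdivlMr// => tpq.
have : - `|q| <= q by rewrite lerNl -normrN ler_norm.
nra.
Unshelve. all: by end_near. Qed.

Lemma near_pinfty_affine_gt0 (p q : R) : 0 < q -> \forall t \near +oo, 0 < p + t * q.
Proof.
move=> q0; near=> t.
have : - p / q < t by near: t; apply: nbhs_pinfty_gt; exact: num_real.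
rewrite ltr_pdivrMr//; lra.
Unshelve. all: by end_near. Qed.

End NearFilters.

(** * Lists of affine forms: solution sets, interiors, recession cones *)

Section Polyhedra.
Local Open Scope ring_scope.
Context {R : realType} {n : nat}.
Local Notation V := 'rV[R]_n.
Implicit Types (s : seq (V * R)) (p : V * R) (ss : seq (seq (V * R))).
Implicit Types (x y u v a : V).

Definition slack p x : R := dot p.1 x - p.2.

Definition poly s : set V := [set x | forall p, p \in s -> 0 <= slack p x].

Definition spoly s : set V := [set x | forall p, p \in s -> 0 < slack p x].

Definition rcone s : set V := [set u | forall p, p \in s -> 0 <= dot p.1 u].

(** The annihilator of the recession cone; it stands in for the linear span of the cone in all
    comparisons of ranks. *)
Definition perp s a := forall u, rcone s u -> dot a u = 0.

Definition nondegenerate s := forall p, p \in s -> p.1 != 0.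

Lemma slackD p x t u : slack p (x + t *: u) = slack p x + t * dot p.1 u.
Proof. by rewrite /slack dotDr dotZr addrAC. Qed.

Lemma poly_cat s s' x : poly (s ++ s') x <-> poly s x /\ poly s' x.
Proof.
split=> [sx|[sx s'x] p]; last by rewrite mem_cat => /orP[/sx|/s'x].
by split=> p ps; apply: sx; rewrite mem_cat ps ?orbT.
Qed.

Lemma spoly_cat s s' x : spoly (s ++ s') x <-> spoly s x /\ spoly s' x.
Proof.
split=> [sx|[sx s'x] p]; last by rewrite mem_cat => /orP[/sx|/s'x].
by split=> p ps; apply: sx; rewrite mem_cat ps ?orbT.
Qed.

Lemma rcone_cat s s' u : rcone (s ++ s') u <-> rcone s u /\ rcone s' u.
Proof.
split=> [su|[su s'u] p]; last by rewrite mem_cat => /orP[/su|/s'u].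
by split=> p ps; apply: su; rewrite mem_cat ps ?orbT.
Qed.

Lemma sub_spoly s : spoly s `<=` poly s.
Proof. by move=> x sx p /sx /ltW. Qed.

Lemma rcone0 s : rcone s 0.
Proof. by move=> p _; rewrite dot0r. Qed.

Lemma rconeZ s t u : 0 <= t -> rcone s u -> rcone s (t *: u).
Proof. by move=> t0 su p ps; rewrite dotZr mulr_ge0// su. Qed.

Lemma rconeD s u v : rcone s u -> rcone s v -> rcone s (u + v).
Proof. by move=> su sv p ps; rewrite dotDr addr_ge0 ?su ?sv. Qed.

Lemma poly_rcone s x t u :
  poly s x -> rcone s u -> 0 <= t -> poly s (x + t *: u).
Proof.
by move=> sx su t0 p ps; rewrite slackD addr_ge0 ?mulr_ge0 ?sx ?su.
Qed.

Lemma spoly_rcone s x t u :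
  spoly s x -> rcone s u -> 0 <= t -> spoly s (x + t *: u).
Proof.
by move=> sx su t0 p ps; rewrite slackD ltr_wpDr ?mulr_ge0 ?sx ?su.
Qed.

Lemma slope_ge0 (p q : R) : (forall t, 0 <= t -> 0 <= p + t * q) -> 0 <= q.
Proof.
move=> pq; rewrite leNgt; apply/negP => q0.
have q1 : 0 < - q by rewrite oppr_gt0.
have [t [t0 tq]] := near_ex2 (near_pinfty_affine_gt0 0 (@ltr01 R))
  (near_pinfty_affine_gt0 (- p) q1).
by have := pq t; lra.
Qed.

Lemma rcone_ray s x u : ray x u `<=` poly s -> rcone s u.
Proof.
move=> su p ps; apply: (@slope_ge0 (slack p x)) => t t0.
by rewrite -slackD; apply: su ps; exists t.
Qed.

Lemma ray_rcone s x u : poly s x -> rcone s u -> ray x u `<=` poly s.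
Proof. by move=> sx su _ [t t0 <-]; exact: poly_rcone. Qed.

(** Nonemptiness matters: the cone is read off the list, and a list without solutions may still have
    nonzero recession directions. *)
Lemma sub_rcone s s' : poly s !=set0 -> poly s `<=` poly s' ->
  rcone s `<=` rcone s'.
Proof.
move=> [x sx] ss' u su; apply: (@rcone_ray _ x).
exact: subset_trans (ray_rcone sx su) ss'.
Qed.

Lemma spoly_near s x u : spoly s x -> \forall t \near 0^'+, spoly s (x + t *: u).
Proof.
move=> sx; apply: near_seq => p ps.
have := near0_affine_gt0 (dot p.1 u) (sx p ps).
by apply: filterS => t; rewrite slackD.
Qed.

Lemma spoly_segment s x y : poly s x -> spoly s y ->
  \forall t \near 0^'+, spoly s (x + t *: (y - x)).
Proof.
move=> sx sy; near=> t => p ps; rewrite slackD.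
have -> : dot p.1 (y - x) = slack p y - slack p x.
  by rewrite /slack dotDr dotNr; ring.
have t0 : 0 < t by near: t; exact: nbhs_right_gt.
have t1 : t < 1 by near: t; exact: nbhs_right_lt.
by have := sx p ps; have := sy p ps; nra.
Unshelve. all: by end_near. Qed.

Lemma continuous_dot a : continuous (dot a).
Proof.
rewrite /dot; apply: continuous_big => [|i _ x].
  by move=> z; apply: cvgD; [exact: cvg_fst|exact: cvg_snd].
apply: (@continuous_comp _ _ _ (fun y : V => y ord0 i) ( *%R (a ord0 i))).
  exact: coord_continuous.
exact: mulrl_continuous.
Qed.

Lemma open_spoly s : open (spoly s).
Proof.
rewrite openE => x sx.
apply: (near_seq (F := nbhs x)) => p ps.
have := sx p ps; rewrite /slack subr_gt0 => px.
have py : \forall y \near x, p.2 < dot p.1 y.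
  exact: (cvgr_gt (FF := nbhs_filter x) _ (@continuous_dot p.1 x) _ px).
by near=> y; rewrite subr_gt0; near: y.
Unshelve. all: by end_near. Qed.

Lemma spoly_sub_interior s : spoly s `<=` (poly s)°.
Proof.
by rewrite -open_subsetE; [exact: sub_spoly|exact: open_spoly].
Qed.

Lemma near_line (A : set V) x u :
  A° x -> \forall t \near 0^'+, A (x + t *: u).
Proof.
move=> Ax.
have cx : (fun t : R => x + t *: u) @ 0 --> x.
  rewrite -[X in _ --> X]addr0 -(scale0r u).
  by apply: cvgD; [exact: cvg_cst|apply: cvgZr_tmp; exact: cvg_id].
exact: (cvg_at_right_filter cx Ax).
Qed.

Lemma interior_poly s : nondegenerate s -> (poly s)° = spoly s.
Proof.
move=> nzs; apply/seteqP; split; last exact: spoly_sub_interior.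
(* A small move against the normal stays in the set and strictly lowers the slack, which was
   therefore positive. *)
move=> x sx p ps; have [t [t0 /(_ p ps)]] :=
  near_ex2 (nbhs_right_gt 0) (near_line (- p.1) sx).
rewrite slackD dotNr mulrN subr_ge0; apply: lt_le_trans.
by rewrite mulr_gt0// dot_gt0// nzs.
Qed.

End Polyhedra.

(** * Generic points and directions; finite covers *)

Section GenericPoints.
Local Open Scope ring_scope.
Context {R : realType} {n : nat}.
Local Notation V := 'rV[R]_n.
Implicit Types (s : seq (V * R)) (p : V * R) (ss : seq (seq (V * R))).
Implicit Types (x y u v a : V).

Lemma near0_affine_neq0 (p q : R) : p != 0 -> \forall t \near 0^'+, p + t * q != 0.
Proof.
move=> p0; wlog p1 : p q p0 / 0 < p => [H|].
  have [/H|p1] := ltP 0 p; first exact.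
  have /(_ (- q)) := H (- p); rewrite oppr_eq0 oppr_gt0 lt_neqAle p0 p1.
  move=> /(_ isT isT); apply: filterS => t.
  by rewrite mulrN -opprD oppr_eq0.
by apply: filterS (near0_affine_gt0 q p1) => t /lt0r_neq0.
Qed.

(** The forms are treated one at a time: if [a] vanishes at [u] but not on [C], a nudge of [u]
    towards a [v] with [dot a v != 0] repairs this, and a small enough nudge keeps the earlier
    nonzero values nonzero. *)
Lemma generic_vector (C : set V) (l : seq V) : C 0 ->
    (forall u v t, C u -> C v -> 0 < t -> C (u + t *: v)) ->
  exists2 u, C u &
    forall a, a \in l -> dot a u = 0 -> forall v, C v -> dot a v = 0.
Proof.
move=> C0 CD; elim: l => [|a l [u Cu ul]]; first by exists 0.
have [[v Cv av]|av] := pselect (exists2 v, C v & dot a v != 0); last first.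
  exists u => // b; rewrite inE => /orP[/eqP -> _ v Cv|]; last exact: ul.
  by apply/eqP/negPn/negP => avN; apply: av; exists v.
have [au|au] := eqVneq (dot a u) 0; last first.
  exists u => // b; rewrite inE => /orP[/eqP -> /eqP|]; last exact: ul.
  by rewrite (negbTE au).
have lt : \forall t \near 0^'+,
    forall b, b \in l -> dot b u != 0 -> dot b u + t * dot b v != 0.
  apply: near_seq => b _; have [->|bu] := eqVneq (dot b u) 0.
    by near=> t.
  by apply: filterS (near0_affine_neq0 (dot b v) bu) => t.
have [t [t0 tl]] := near_ex2 (nbhs_right_gt (0 : R)) lt.
exists (u + t *: v); first exact: CD.
move=> b; rewrite inE dotDr dotZr => /orP[/eqP ->|bl b0 w Cw].
  by move/eqP; rewrite au add0r mulf_eq0 (negbTE av) gt_eqF.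
apply: (ul _ bl) => //; apply/eqP/negPn/negP => /(tl _ bl).
by rewrite b0 eqxx.
Unshelve. all: by end_near. Qed.

Lemma generic_direction (l : seq V) :
  exists u, forall a, a \in l -> a != 0 -> dot a u != 0.
Proof.
have [|//|u _ ul] := @generic_vector setT l => //.
exists u => a al; apply: contraNneq => au; apply/eqP/dot_nondeg => v.
by rewrite dotC (ul a).
Qed.

Definition covers (A : set V) ss :=
  forall x, A x -> exists2 s, s \in ss & poly s x.

(* Follow a generic ray from a generic point: it ends up in the interior of a
   single member of the cover. *)
Lemma generic_ray s ss : spoly s !=set0 ->
    (forall s', s' \in ss -> nondegenerate s') -> covers (poly s) ss ->
  exists2 s', s' \in ss & spoly (s ++ s') !=set0 /\
    exists2 u, rcone (s ++ s') u & forall v, rcone s v ->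
      \forall t \near 0^'+, rcone (s ++ s') (u + t *: v).
Proof.
move=> [x0 sx0] nzss cov.
(* The base point is first moved off every hyperplane of the cover, so that no slack can be zero all
   along a ray parallel to its hyperplane. *)
have [v vl] := generic_direction [seq p.1 | p <- flatten ss].
have xn : \forall t \near 0^'+, forall p, p \in flatten ss ->
    slack p (x0 + t *: v) != 0.
  apply: near_seq => p pss.
  have pv : dot p.1 v != 0.
    apply: vl; first by apply/mapP; exists p.
    by have /flattenP[s' /nzss nzs' /nzs'] := pss.
  have [p0|p0] := eqVneq (slack p x0) 0; last first.
    by apply: filterS (near0_affine_neq0 (dot p.1 v) p0) => t; rewrite slackD.
  near=> t; have t0 : 0 < t by near: t; exact: nbhs_right_gt.
  by rewrite slackD p0 add0r mulf_neq0// gt_eqF.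
have [t [sx xss]] := near_ex2 (spoly_near v sx0) xn.
move: (x0 + t *: v) sx xss => x sx xss {x0 sx0 v vl xn t}.
(* The direction is generic within the cone: a normal of the cover that vanishes at [u] vanishes on
   all of [rcone s]. *)
have [|u su ul] := @generic_vector (rcone s) [seq p.1 | p <- flatten ss]
    (@rcone0 _ _ s).
  by move=> u v t su sv /ltW t0; apply: rconeD => //; exact: rconeZ.
(* Far out on the ray the sign of every slack has stabilised and agrees with that of its slope,
   unless the slope is 0. *)
have un : \forall t \near +oo, 0 <= t /\ forall p, p \in flatten ss ->
    0 <= slack p (x + t *: u) -> 0 < slack p (x + t *: u) /\ 0 <= dot p.1 u.
  near=> t; split; first by near: t; apply: nbhs_pinfty_ge; exact: num_real.
  near: t; apply: near_seq => p pss.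
  have [u0|u0|u0] := ltgtP (dot p.1 u) 0.
  - have : \forall t \near +oo, 0 < - slack p x + t * - dot p.1 u.
      by apply: near_pinfty_affine_gt0; rewrite oppr_gt0.
    by apply: filterS => t; rewrite slackD; lra.
  - have := near_pinfty_affine_gt0 (slack p x) u0.
    by apply: filterS => t; rewrite slackD; lra.
  - near=> t; rewrite slackD u0 mulr0 addr0 lt_def => ->.
    by rewrite xss.
have /filter_ex[t [t0 tss]] := un.
have [s' s'ss s'x] := cov _ (poly_rcone (sub_spoly sx) su t0).
have s'fl p : p \in s' -> p \in flatten ss by move=> ?; apply/flattenP; exists s'.
exists s' => //; split.
  exists (x + t *: u); apply/spoly_cat; split; first exact: spoly_rcone.
  by move=> p ps'; have [] := tss p (s'fl _ ps') (s'x _ ps').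
have s'u p (ps' : p \in s') : 0 <= dot p.1 u.
  by have [] := tss p (s'fl _ ps') (s'x _ ps').
exists u; first by apply/rcone_cat.
(* Constraints of [s'] that are positive at [u] survive a small step towards [v]; those that vanish
   at [u] also vanish at [v]. *)
move=> v sv.
have s'uv : \forall t \near 0^'+, rcone s' (u + t *: v).
  apply: near_seq => p ps'.
  have := s'u p ps'; rewrite le_eqVlt => /predU1P[/esym pu|pu].
    have pv : dot p.1 v = 0.
      by apply: (ul p.1) => //; apply/mapP; exists p => //; exact: s'fl.
    by near=> r; rewrite dotDr dotZr pu pv mulr0 addr0.
  by apply: filterS (near0_affine_gt0 (dot p.1 v) pu) => r /ltW; rewrite dotDr dotZr.
near=> r; apply/rcone_cat; split; last by near: r.
apply: rconeD => //; apply: rconeZ => //.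
Unshelve. all: by end_near. Qed.

(** The direction [u] of [generic_ray] is relatively interior: a form that vanishes on the smaller
    cone vanishes at [u] and at [u + t *: v], hence at [v]. Some member of the cover thus meets
    [poly s] in full rank. *)
Lemma covers_full_rank s ss : spoly s !=set0 ->
    (forall s', s' \in ss -> nondegenerate s') -> covers (poly s) ss ->
  exists2 s', s' \in ss & spoly (s ++ s') !=set0 /\
    forall a, perp (s ++ s') a -> perp s a.
Proof.
move=> s0 nz cov; have [s' s'ss [ss'0 [u su suv]]] := generic_ray s0 nz cov.
exists s' => //; split=> // a sa v sv.
have [t [t0 /sa]] := near_ex2 (nbhs_right_gt 0) (suv v sv).
rewrite dotDr dotZr sa// add0r => /eqP.
by rewrite mulf_eq0 gt_eqF//= => /eqP.
Qed.

Lemma covers_thick ss : (forall s, s \in ss -> nondegenerate s) ->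
  covers setT ss -> covers setT [seq s <- ss | `[< spoly s !=set0 >]].
Proof.
move=> nz cov x _.
have [v vl] := generic_direction [seq p.1 | p <- flatten ss].
(* A point close to [x] in a generic direction lies on no hyperplane of the cover, and the
   constraints it satisfies also hold at [x]; the member containing it is thick and contains [x]. *)
have xn : \forall t \near 0^'+, forall p, p \in flatten ss ->
    0 <= slack p (x + t *: v) -> 0 < slack p (x + t *: v) /\ 0 <= slack p x.
  apply: near_seq => p pss.
  have [x0|x0|x0] := ltgtP (slack p x) 0.
  - have : \forall t \near 0^'+, 0 < - slack p x + t * - dot p.1 v.
      by apply: near0_affine_gt0; rewrite oppr_gt0.
    by apply: filterS => t; rewrite slackD; lra.
  - have := near0_affine_gt0 (dot p.1 v) x0.
    by apply: filterS => t; rewrite slackD; lra.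
  - near=> t; have t0 : 0 < t by near: t; exact: nbhs_right_gt.
    rewrite slackD x0 add0r lt_def => ->; rewrite andbT.
    split=> //; rewrite mulf_neq0 ?(gt_eqF t0)//.
    apply: vl; first by apply/mapP; exists p.
    by have /flattenP[s' /nz nzs' /nzs'] := pss.
have /filter_ex[t tss] := xn.
have [s sss sx] := cov (x + t *: v) I.
have sxx p (ps : p \in s) : 0 < slack p (x + t *: v) /\ 0 <= slack p x.
  by apply: (tss p _ (sx p ps)); apply/flattenP; exists s.
exists s; last by move=> p /sxx[].
rewrite mem_filter sss andbT; apply/asboolP; exists (x + t *: v).
by move=> p /sxx[].
Unshelve. all: by end_near. Qed.

End GenericPoints.

(** * Rank of polyhedral sets and annihilators *)

Section Rank.
Local Open Scope ring_scope.
Context {R : realType} {n : nat}.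
Local Notation V := 'rV[R]_n.
Implicit Types (C : set V) (s : seq (V * R)) (a u v : V).

Lemma greatestE (A : set int) m : A m -> (forall k, A k -> k <= m) ->
  greatest A = m.
Proof.
move=> Am max_m; rewrite /greatest; apply: xget_unique => // k [Ak max_k].
by apply/eqP; rewrite eq_le max_m// max_k.
Qed.

Lemma greatest_ge (A : set int) m b : A m -> (forall k, A k -> k <= b) ->
  m <= greatest A.
Proof.
(* Distances to the bound [b] are natural numbers, so the greatest element is the one at least
   distance. *)
move=> Am Ab; have distb k : A k -> b - (`|b - k|%N)%:Z = k.
  by move=> /Ab kb; rewrite abszE ger0_norm ?subr_ge0//; ring.
have : exists d : nat, `[< A (b - d%:Z) >].
  by exists `|b - m|%N; apply/asboolP; rewrite distb.
move=> /ex_minnP[d /asboolP Ad mind].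
have max k : A k -> k <= b - d%:Z.
  move=> Ak; rewrite -(distb k Ak) lerD2l lerN2 lez_nat mind//.
  by apply/asboolP; rewrite distb.
by rewrite (greatestE Ad max) max.
Qed.

Lemma dotE a u : dot a u = (u *m a^T) ord0 ord0.
Proof. by rewrite dotC mxE; apply: eq_bigr => i _; rewrite mxE. Qed.

Lemma rk_set0 : rk (@set0 V) = - 1.
Proof. by rewrite /rk; case: asboolP. Qed.

(** A maximal independent family of limit directions spans them all: a direction outside its row
    space could be appended as a new row. *)
Lemma rkP C : C !=set0 -> exists k (M : 'M[R]_(k, n)),
  [/\ rk C = k%:Z, row_free M, forall i, limit_set C (row i M) &
      forall u, limit_set C u -> (u <= M)%MS].
Proof.
move=> C0; pose P k := `[< exists M : 'M[R]_(k, n),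
  row_free M /\ forall i, limit_set C (row i M) >].
have P0 : exists k, P k.
  exists 0; apply/asboolP; exists 0; split; last by case.
  by rewrite /row_free mxrank0.
have Pn k : P k -> (k <= n)%N.
  by move=> /asboolP[M [freeM _]]; rewrite -(eqP freeM) rank_leq_col.
case: (ex_maxnP P0 Pn) => k /asboolP[M [freeM CM]] maxk.
exists k, M; split=> //; last first.
  move=> u Cu; apply: contraT => uM.
  suff /maxk : P (k + 1)%N by rewrite addn1 ltnn.
  apply/asboolP; exists (col_mx M u); split; last first.
    by move=> i; case: (split_ordP i) => j ->; rewrite ?rowKu ?rowKd ?row_id.
  rewrite /row_free -addsmxE mxrank_disjoint_sum; last first.
    apply/eqP; rewrite -mxrank_eq0; apply: contraNT uM => Mu.
    have := mxrankS (capmxSr M u).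
    rewrite leq_eqVlt => /orP[|/leq_trans /(_ (rank_leq_row u))]; last first.
      by rewrite ltnS leqn0 (negbTE Mu).
    rewrite (mxrank_leqif_sup (capmxSr M u)) => /submx_trans; apply.
    exact: capmxSl.
  rewrite (eqP freeM) rank_rV; have [u0|//] := eqVneq u 0.
  by move: uM; rewrite u0 sub0mx.
rewrite /rk; case: asboolP => [CE|_]; first by case: C0; rewrite CE.
apply: greatestE => [|_ [j [N NP] <-]]; first by exists k => //; exists M.
by rewrite lez_nat maxk//; apply/asboolP; exists N.
Qed.

Lemma rk_ge0 C : C !=set0 -> 0 <= rk C.
Proof. by move=> /rkP[k [M [-> _ _ _]]]. Qed.

Lemma rk_leT C : rk C <= n%:Z.
Proof.
have [->|/set0P/rkP[k [M [-> freeM _ _]]]] := eqVneq C set0.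
  by rewrite rk_set0.
by rewrite lez_nat -(eqP freeM) rank_leq_col.
Qed.

Lemma rk_le_linear C C' (Phi : 'M[R]_n) : Phi \in unitmx ->
    C !=set0 -> C' !=set0 ->
    (forall u, limit_set C u -> limit_set C' (u *m Phi)) -> rk C <= rk C'.
Proof.
move=> PhiU /rkP[k [M [-> freeM CM _]]] /rkP[k' [M' [-> freeM' _ C'M]]] CC'.
rewrite lez_nat -(eqP freeM) -(eqP freeM') -(mxrankMfree M (_ : row_free Phi));
  last by rewrite row_free_unit.
by apply/mxrankS/row_subP => i; rewrite row_mul; apply/C'M/CC'.
Qed.

Lemma rk_le C C' : C !=set0 -> C' !=set0 -> limit_set C `<=` limit_set C' ->
  rk C <= rk C'.
Proof.
move=> C0 C'0 CC'; apply: (@rk_le_linear _ _ 1%:M) => // [|u /CC'].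
  exact: unitmx1.
by rewrite mulmx1.
Qed.

(** Nested spans of equal rank coincide, so they are killed by the same forms; conversely a span is
    recovered from the forms that kill it. *)
Lemma rk_eqP C C' : C !=set0 -> C' !=set0 -> limit_set C `<=` limit_set C' ->
  rk C = rk C' <->
  (forall a, (forall u, limit_set C u -> dot a u = 0) ->
             forall u, limit_set C' u -> dot a u = 0).
Proof.
move=> C0 C'0 CC'; have [k [M [rkC freeM CM MC]]] := rkP C0.
have [k' [M' [rkC' freeM' CM' MC']]] := rkP C'0.
have sMM' : (M <= M')%MS by apply/row_subP => i; apply/MC'/CC'.
split=> [|perpC].
  rewrite rkC rkC' => -[kk'] a aC u /MC' uM'.
  have uM : (u <= M)%MS.
    apply: submx_trans uM' _.
    by rewrite -(mxrank_leqif_sup sMM') (eqP freeM) (eqP freeM') kk'.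
  have Ma : M *m a^T = 0.
    apply/row_matrixP => i; rewrite row_mul row0.
    by apply/matrixP => p q; rewrite !ord1 -dotE aC// mxE.
  by have /submxP[D ->] := uM; rewrite dotE -mulmxA Ma mulmx0 mxE.
apply/eqP; rewrite eq_le rk_le//= rkC rkC' -(eqP freeM) -(eqP freeM') lez_nat.
(* The test forms are the columns of [cokermx M]: they vanish on the limit set of [C], hence on that
   of [C'], which places the rows of [M'] in the row space of [M]. *)
apply: mxrankS; rewrite submxE; apply/eqP/matrixP => i j; rewrite [RHS]mxE.
have dcol (N : V) : dot (col j (cokermx M))^T N = (N *m cokermx M) ord0 j.
  by rewrite /dot mxE; apply: eq_bigr => k0 _; rewrite !mxE mulrC.
have /perpC/(_ _ (CM' i)) : forall u, limit_set C u ->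
    dot (col j (cokermx M))^T u = 0.
  by move=> u /MC; rewrite submxE dcol => /eqP ->; rewrite mxE.
by rewrite dcol -row_mul mxE.
Qed.

Lemma enorm_eq1 u : (enorm u == 1) = (dot u u == 1).
Proof.
rewrite /enorm -[X in _ == X]sqrtr1 eqr_sqrt ?dot_ge0//.
Qed.

Lemma enorm_gt0 u : u != 0 -> 0 < enorm u.
Proof. by move=> u0; rewrite sqrtr_gt0 dot_gt0. Qed.

Lemma enorm_normalize u : u != 0 -> enorm ((enorm u)^-1 *: u) = 1.
Proof.
move=> u0; have := enorm_gt0 u0 => e0; apply/eqP.
rewrite enorm_eq1 dotZr dotZl -[dot u u]sqr_sqrtr ?dot_ge0// -/(enorm u) expr2.
by apply/eqP; field; rewrite gt_eqF.
Qed.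

Lemma limit_set_poly s u : poly s !=set0 ->
  limit_set (poly s) u <-> enorm u = 1 /\ rcone s u.
Proof.
move=> [x sx]; split=> -[u1 su]; split=> //; first by have [y /rcone_ray] := su.
by exists x; exact: ray_rcone.
Qed.

Lemma perp_limit_set s a : poly s !=set0 ->
  (forall u, limit_set (poly s) u -> dot a u = 0) <-> perp s a.
Proof.
move=> s0; split=> sa u; last by move=> /(limit_set_poly _ s0)[_ /sa].
have [-> _|u0 su] := eqVneq u 0; first by rewrite dot0r.
have := sa ((enorm u)^-1 *: u); rewrite dotZr => /(_ _)/eqP.
rewrite mulf_eq0 invr_eq0 (gt_eqF (enorm_gt0 u0))/= => /(_ _)/eqP; apply.
apply/limit_set_poly => //; rewrite enorm_normalize//; split=> //.
by apply: rconeZ => //; rewrite invr_ge0 ltW// enorm_gt0.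
Qed.

Lemma sub_limit_set s s' : poly s !=set0 -> rcone s `<=` rcone s' ->
  poly s' !=set0 -> limit_set (poly s) `<=` limit_set (poly s').
Proof.
move=> s0 ss' s'0 u /limit_set_poly-/(_ s0)[u1 su].
by apply/limit_set_poly => //; split=> //; exact: ss'.
Qed.

Lemma eq_limit_set s s' : poly s !=set0 -> poly s' !=set0 ->
  limit_set (poly s) = limit_set (poly s') <-> rcone s = rcone s'.
Proof.
move=> s0 s'0; split=> [eqL|eqC]; last first.
  by apply/seteqP; split; apply: sub_limit_set => //; rewrite eqC.
suff sub (t t' : seq (V * R)) : poly t !=set0 -> poly t' !=set0 ->
    limit_set (poly t) = limit_set (poly t') -> rcone t `<=` rcone t'.
  by apply/seteqP; split; apply: sub.
move=> t0 t'0 eqt u tu.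
have [->|u0] := eqVneq u 0; first exact: rcone0.
have e0 := enorm_gt0 u0.
suff : rcone t' ((enorm u)^-1 *: u).
  move=> /(@rconeZ _ _ _ (enorm u)); rewrite scalerA divff ?gt_eqF// scale1r.
  by apply; exact: ltW.
suff /(limit_set_poly _ t'0)[] : limit_set (poly t') ((enorm u)^-1 *: u) by [].
rewrite -eqt; apply/limit_set_poly => //.
rewrite enorm_normalize//; split=> //.
by apply: rconeZ => //; rewrite invr_ge0 ltW.
Qed.

Lemma rk_poly_le s s' : poly s !=set0 -> poly s `<=` poly s' ->
  rk (poly s) <= rk (poly s').
Proof.
move=> s0 ss'; have s'0 : poly s' !=set0 by have [x /ss'] := s0; exists x.
by apply: rk_le => //; apply: sub_limit_set => //; exact: sub_rcone.
Qed.

Lemma rk_poly_eqP s s' : poly s !=set0 -> poly s `<=` poly s' ->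
  rk (poly s) = rk (poly s') <-> (forall a, perp s a -> perp s' a).
Proof.
move=> s0 ss'; have s'0 : poly s' !=set0 by have [x /ss'] := s0; exists x.
have [|H1 H2] := @rk_eqP (poly s) (poly s') s0 s'0.
  by apply: sub_limit_set => //; exact: sub_rcone.
split=> [/H1 ss a /(perp_limit_set a s0)/ss/(perp_limit_set a s'0)//|ss].
by apply: H2 => a /(perp_limit_set a s0)/ss/(perp_limit_set a s'0).
Qed.

End Rank.

(** * Irreducibility tested by single walls *)

Section Irreducibility.
Local Open Scope ring_scope.
Context {R : realType} {n : nat}.
Local Notation V := 'rV[R]_n.
Variable Omega : set (set V).
Implicit Types (s t l : seq (V * R)) (p q : V * R) (P Q : set V) (u v x : V).

Definition wall p := p.1 != 0 /\ Omega (hyperplane p.1 p.2).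

Definition walled s := forall p, p \in s -> wall p.

(** These lists present exactly the nonempty convex polyhedral sets, by [polyhedral_poly] and
    [polyhedralP]. *)
Definition solid s := walled s /\ spoly s !=set0.

Lemma wallN p : wall p -> wall (- p.1, - p.2).
Proof.
move=> [p0 Op]; split; rewrite /= ?oppr_eq0//.
suff -> : hyperplane (- p.1) (- p.2) = hyperplane p.1 p.2 by [].
by apply/seteqP; split=> x; rewrite /hyperplane /= dotNl; [move/oppr_inj|move=> ->].
Qed.

Lemma slackN p x : slack (- p.1, - p.2) x = - slack p x.
Proof. by rewrite /slack dotNl opprB opprK addrC. Qed.

Lemma walled_cat s t : walled (s ++ t) <-> walled s /\ walled t.
Proof.
split=> [h|[h h'] p]; last by rewrite mem_cat => /orP[/h|/h'].
by split=> p ps; apply: h; rewrite mem_cat ps ?orbT.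
Qed.

Lemma walled1 p : walled [:: p] <-> wall p.
Proof.
by split=> [|wp q]; [apply; rewrite mem_head|rewrite inE => /eqP ->].
Qed.

Lemma walled_nondegenerate s : walled s -> nondegenerate s.
Proof. by move=> ws p /ws[]. Qed.

Lemma poly_catE s t : poly (s ++ t) = poly s `&` poly t.
Proof. by apply/seteqP; split=> x /poly_cat. Qed.

Lemma solid_poly s : solid s -> poly s !=set0.
Proof. by move=> [_ [x /sub_spoly]]; exists x. Qed.

Lemma solid_sub_strict s p : solid s -> wall p ->
  (forall x, poly s x -> 0 <= slack p x) -> forall x, spoly s x -> 0 < slack p x.
Proof.
move=> [ws _] [p0 _] sp x.
rewrite -(interior_poly (walled_nondegenerate ws)) => sx.
have [t [t0 /sp]] := near_ex2 (nbhs_right_gt 0) (near_line (- p.1) sx).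
rewrite slackD dotNr mulrN subr_ge0; apply: lt_le_trans.
by rewrite mulr_gt0// dot_gt0.
Qed.

Lemma polyhedral_poly s : solid s -> polyhedral Omega (poly s).
Proof.
move=> [ws s0]; right; rewrite interior_poly; last exact: walled_nondegenerate.
split=> //; pose h p := [set x : V | p.2 <= dot p.1 x].
exists (h @` [set` s]); split.
- by apply: finite_image; exact: finite_seq.
- by move=> _ [p /= /ws[p0 Op] <-]; exists p.1, p.2.
- apply/seteqP; split=> [x sx _ [p /= ps <-]|x sx p ps].
    by have := sx p ps; rewrite /slack subr_ge0.
  rewrite /slack subr_ge0.
  by have := sx (h p); rewrite /h; apply; exists p.
Qed.

Lemma polyhedralP P : polyhedral Omega P ->
  P = set0 \/ exists2 s, solid s & P = poly s.
Proof.
move=> [->|[P0 [F [/finite_seqP[l ->] lh PE]]]]; [by left|right].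
suff [s ws sl] : exists2 s, walled s &
    forall x, poly s x <-> (forall h, h \in l -> h x).
  have Ps : P = poly s.
    by rewrite PE; apply/seteqP; split=> x; [move=> lx; apply/sl|move/sl].
  exists s => //; split=> //.
  by rewrite -interior_poly -?Ps//; exact: walled_nondegenerate.
elim: l lh {PE} => [_|h l IH lh]; first by exists [::].
have [|s ws sl] := IH; first by move=> k kl; apply: lh; rewrite /= inE kl orbT.
have [a [b [a0 Oab hE]]] := lh h (mem_head _ _).
have hab x : h x <-> 0 <= slack (a, b) x by rewrite hE /slack subr_ge0.
exists ((a, b) :: s) => [p|x].
  by rewrite inE => /orP[/eqP ->|/ws].
split=> [sx k|lx p].
  rewrite inE => /orP[/eqP ->|]; first by apply/hab; apply: sx; rewrite mem_head.
  by apply: (sl x).1 => p ps; apply: sx; rewrite inE ps orbT.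
rewrite inE => /orP[/eqP ->|ps]; first by apply/hab; apply: lx; rewrite mem_head.
by apply: (sl x).2 => // k kl; apply: lx; rewrite inE kl orbT.
Qed.

Lemma ess_inter_poly s t : walled s -> walled t ->
  ess_inter (poly s) (poly t) !=set0 <-> spoly (s ++ t) !=set0.
Proof.
move=> ws wt; rewrite /ess_inter -poly_catE interior_poly; last first.
  by apply: walled_nondegenerate; apply/walled_cat.
case: asboolP => [st0|st0]; last by split=> // -[].
by split=> // -[x /sub_spoly]; exists x.
Qed.

Lemma ess_disjointP P Q : ess_disjoint P Q <-> ~ (ess_inter P Q !=set0).
Proof.
by split=> [-> []//|PQ]; apply/eqP/negPn/negP => /set0P.
Qed.

Lemma decomposition_seq D X : decomposition Omega D X ->
  exists ss : seq (seq (V * R)),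
    (forall s, s \in ss -> solid s /\ D (poly s)) /\
    (forall P, D P -> P !=set0 -> exists2 s, s \in ss & P = poly s).
Proof.
move=> [/finite_seqP[l ->] lP _ _].
suff [ss [ssl lss]] : exists ss : seq (seq (V * R)),
    (forall s, s \in ss -> solid s /\ poly s \in l) /\
    (forall P, P \in l -> P !=set0 -> exists2 s, s \in ss & P = poly s).
  by exists ss.
elim: l lP => [_|P l IH lP]; first by exists [::].
have [|ss [ssl lss]] := IH.
  by move=> Q Ql; apply: lP; rewrite /= inE Ql orbT.
have [P0|[s solid_s Ps]] := polyhedralP (lP P (mem_head _ _)).
  exists ss; split=> [s /ssl[ssol sl]|Q].
    by split=> //; rewrite inE sl orbT.
  by rewrite inE => /orP[/eqP -> [x]|/lss//]; rewrite P0.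
exists (s :: ss); split=> [t|Q].
  rewrite inE => /orP[/eqP ->|/ssl[tsol tl]]; first by rewrite -Ps mem_head.
  by split=> //; rewrite inE tl orbT.
rewrite inE => /orP[/eqP -> _|Ql /(lss _ Ql)[t tss Qt]].
  by exists s => //; rewrite mem_head.
by exists t => //; rewrite inE tss orbT.
Qed.

(* Irreducibility of [poly s] without reference to decompositions; see
   [irreducible_irr] and [irr_irreducible]. *)
Definition irr s := forall p, wall p ->
  (exists2 x, poly s x & slack p x < 0) -> (exists2 x, poly s x & 0 < slack p x) ->
  ((forall u, rcone s u -> 0 <= dot p.1 u) \/
   (forall u, rcone s u -> dot p.1 u <= 0)) /\ ~ perp s p.1.

(* Up to a translation along the recession cone, [poly s] satisfies the
   constraint [p]. *)
Definition tail_nonneg s p := (forall x, poly s x -> 0 <= slack p x) \/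
  ((forall u, rcone s u -> 0 <= dot p.1 u) /\
   exists2 u, rcone s u & 0 < dot p.1 u).

Lemma not_perp s a : ~ perp s a -> exists2 u, rcone s u & dot a u != 0.
Proof.
move=> sa; have [//|su] := pselect (exists2 u, rcone s u & dot a u != 0).
case: sa => u ?; apply/eqP/negPn/negP => au.
by apply: su; exists u.
Qed.

Lemma tail_nonneg_rcone s p u : poly s !=set0 -> tail_nonneg s p ->
  rcone s u -> 0 <= dot p.1 u.
Proof.
move=> [x sx] [sp|[sp _]] su; last exact: sp.
apply: (@slope_ge0 _ (slack p x)) => t t0; rewrite -slackD; apply: sp.
exact: poly_rcone.
Qed.

(** A constraint [p] of [t] that fails somewhere on [poly s] cuts it, so [irr] gives it a sign on
    the cone. A nonpositive sign would make [p] vanish on [rcone t], hence on [rcone s] by equality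
    of annihilators, which [irr] excludes. *)
Lemma irr_tail_nonneg s t p : irr s -> solid t -> poly t `<=` poly s ->
  (forall a, perp t a -> perp s a) -> p \in t -> tail_nonneg s p.
Proof.
move=> irrs [wt [y ty]] ts perpts pt.
have [sp|/existsNP[x /not_implyP[sx px]]] :=
  pselect (forall x, poly s x -> 0 <= slack p x); [by left|right].
have [||[sp|sp] np] := irrs p (wt p pt).
- by exists x => //; rewrite ltNge; exact/negP.
- by exists y; [exact/ts/sub_spoly|exact: ty].
- split=> //; have [u su pu] := not_perp np.
  by exists u => //; rewrite lt_def pu sp.
- exfalso; apply/np/perpts => u tu; apply/eqP; rewrite eq_le tu// sp//.
  by apply: sub_rcone ts _ tu; exists y; exact: sub_spoly.
Qed.

Lemma irr_sub_rcone s t : solid s -> irr s -> solid t -> poly t `<=` poly s ->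
  (forall a, perp t a -> perp s a) -> rcone t = rcone s.
Proof.
move=> solids irrs solidt ts perpts; apply/seteqP; split.
  exact: sub_rcone (solid_poly solidt) ts.
move=> u su p pt; apply: tail_nonneg_rcone su; first exact: solid_poly.
exact: irr_tail_nonneg pt.
Qed.

Lemma irr_sub s t : irr s -> poly t `<=` poly s -> rcone t = rcone s -> irr t.
Proof.
move=> irrs ts Ets p wp [x tx px] [y ty py]; rewrite /perp Ets.
by apply: irrs => //; [exists x => //; exact: ts|exists y => //; exact: ts].
Qed.

(** The constraints of [l] are added one by one. Each either holds on all of [poly s] already, or is
    achieved by pushing an interior point along the cone; the push respects the earlier constraints
    because the cone has not shrunk. *)
Lemma tail_nonneg_cat s t l : walled l -> solid t -> poly t `<=` poly s ->
    rcone t = rcone s -> (forall p, p \in l -> tail_nonneg s p) ->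
  spoly (t ++ l) !=set0 /\ rcone (t ++ l) = rcone s.
Proof.
move=> + + ts Ets; elim: l => [_ [_ t0] _|p l IH wl solidt lp].
  by rewrite cats0.
have sub q : q \in l -> q \in p :: l by rewrite inE orbC => ->.
have wl' : walled l by move=> q /sub/wl.
have lp' q : q \in l -> tail_nonneg s q by move=> /sub/lp.
have [[y tly] Etl] := IH wl' solidt lp'.
have wp := wl p (mem_head _ _); have tp := lp p (mem_head _ _).
have pu u : rcone s u -> 0 <= dot p.1 u.
  apply: tail_nonneg_rcone tp; have [x tx] := solid_poly solidt.
  by exists x; exact: ts.
split; last first.
  apply/seteqP; rewrite -Etl; split=> u tu q qtl.
    by apply: tu; move: qtl; rewrite !mem_cat inE => /orP[]->; rewrite ?orbT.
  move: qtl; rewrite mem_cat inE orbCA -mem_cat => /orP[/eqP ->|/tu//].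
  by apply: pu; rewrite -Etl.
suff [x tlx px] : exists2 x, spoly (t ++ l) x & 0 < slack p x.
  exists x => q; rewrite mem_cat inE orbCA -mem_cat => /orP[/eqP ->//|].
  exact: tlx.
case: tp => [sp|[_ [u su pu0]]].
  exists y => //; apply: (solid_sub_strict solidt wp); first by move=> z /ts/sp.
  by move/spoly_cat : tly => [].
have [r [r0 pr]] := near_ex2 (near_pinfty_affine_gt0 0 (@ltr01 R))
  (near_pinfty_affine_gt0 (slack p y) pu0).
exists (y + r *: u); last by rewrite slackD.
by apply: spoly_rcone => //; [rewrite Etl|lra].
Qed.

(** If [p] vanishes on the cone, cutting does not change the cone. If [p] is positive at some [u],
    then [u] and all small perturbations [u + t *: v] survive, so no new form kills the cone. *)
Lemma rk_halfspace s p : solid s -> spoly (s ++ [:: p]) !=set0 ->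
  perp s p.1 \/ (exists2 u, rcone s u & 0 < dot p.1 u) ->
  rk (poly (s ++ [:: p])) = rk (poly s).
Proof.
move=> solids [y spy] sp.
have sub : poly (s ++ [:: p]) `<=` poly s by move=> x /poly_cat[].
apply/rk_poly_eqP => //; first by exists y; exact: sub_spoly.
move=> a spa; case: sp => [pp|[u su pu]] v sv.
  apply: spa; apply/rcone_cat; split=> // q.
  by rewrite inE => /eqP ->; rewrite pp.
have spu : rcone (s ++ [:: p]) u.
  by apply/rcone_cat; split=> // q; rewrite inE => /eqP ->; exact: ltW.
have [t [t0 pt]] := near_ex2 (nbhs_right_gt 0) (near0_affine_gt0 (dot p.1 v) pu).
have : rcone (s ++ [:: p]) (u + t *: v).
  apply/rcone_cat; split.
    by apply: rconeD => //; apply: rconeZ => //; exact: ltW.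
  by move=> q; rewrite inE => /eqP ->; rewrite dotDr dotZr ltW.
move=> /spa; rewrite dotDr dotZr spa// add0r => /eqP.
by rewrite mulf_eq0 gt_eqF//= => /eqP.
Qed.

Lemma spoly_halfspace s p x : solid s -> poly s x -> 0 < slack p x ->
  spoly (s ++ [:: p]) !=set0.
Proof.
move=> [_ [y sy]] sx px.
have [r [sr pr]] := near_ex2 (spoly_segment sx sy)
  (near0_affine_gt0 (dot p.1 (y - x)) px).
exists (x + r *: (y - x)); apply/spoly_cat; split=> // q.
by rewrite inE => /eqP ->; rewrite slackD.
Qed.

Lemma irreducible_irr s : solid s -> irreducible Omega (poly s) -> irr s.
Proof.
move=> solids [_ irrs] p wp [x sx px] [y sy py].
pose p' := (- p.1, - p.2); pose P1 := poly (s ++ [:: p]).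
pose P2 := poly (s ++ [:: p']).
have sp : spoly (s ++ [:: p]) !=set0 by exact: spoly_halfspace py.
have sp' : spoly (s ++ [:: p']) !=set0.
  by apply: (spoly_halfspace (x := x)) => //; rewrite slackN oppr_gt0.
have solid1 : solid (s ++ [:: p]).
  by split=> //; apply/walled_cat; split; [exact: solids.1|exact/walled1].
have solid2 : solid (s ++ [:: p']).
  split=> //; apply/walled_cat; split; first exact: solids.1.
  exact/walled1/wallN.
have P12 : P1 <> P2.
  move=> E; have : P2 y.
    by rewrite -E; apply/poly_cat; split=> // q; rewrite inE => /eqP ->; exact: ltW.
  by move=> /poly_cat[_ /(_ p' (mem_head _ _))]; rewrite slackN; lra.
have disj : ess_disjoint P1 P2.
  apply/ess_disjointP; rewrite ess_inter_poly; [|exact: solid1.1|exact: solid2.1].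
  move=> [z /spoly_cat[/spoly_cat[_ zp] /spoly_cat[_ zp']]].
  have := zp p (mem_head _ _); have := zp' p' (mem_head _ _).
  by rewrite slackN; lra.
have dec : decomposition Omega [set P1; P2] (poly s).
  split.
  - exact: finite_set2.
  - by move=> _ [->|->]; exact: polyhedral_poly.
  - move=> _ _ [->|->] [->|->]//.
    by rewrite /ess_disjoint /ess_inter setIC.
  - rewrite bigcup_setU !bigcup_set1; apply/seteqP; split=> z.
      by case=> /poly_cat[].
    move=> sz; have [pz|pz] := leP 0 (slack p z); [left|right]; apply/poly_cat.
      by split=> // q; rewrite inE => /eqP ->.
    by split=> // q; rewrite inE => /eqP ->; rewrite slackN oppr_ge0 ltW.
have [Q [[_ _] uniqQ]] := irrs _ dec.
(* If [p] took both signs on the cone, or vanished there, both halves would have full rank, against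
   the uniqueness in the definition of irreducibility. *)
have not_both : rk P1 = rk (poly s) -> rk P2 = rk (poly s) -> False.
  move=> r1 r2; apply: P12; rewrite -(uniqQ P1); last by split=> //; left.
  by rewrite -(uniqQ P2)//; split=> //; right.
have rk1 := rk_halfspace solids sp; have rk2 := rk_halfspace solids sp'.
have neg u : rcone s u -> dot p.1 u < 0 -> exists2 u, rcone s u & 0 < dot p'.1 u.
  by move=> su pu; exists u => //; rewrite dotNl oppr_gt0.
split; last first.
  move=> perpp; apply: not_both; [apply: rk1|apply: rk2]; left => // u su.
  by rewrite dotNl perpp ?oppr0.
have [[u su pu]|nu] := pselect (exists2 u, rcone s u & dot p.1 u < 0); last first.
  by left=> u su; rewrite leNgt; apply/negP => pu; apply: nu; exists u.
right=> v sv; rewrite leNgt; apply/negP => pv; apply: not_both.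
  by apply: rk1; right; exists v.
by apply: rk2; right; exact: neg pu.
Qed.

(** A full-rank member exists by [covers_full_rank]. Two of them overlap, since a point of one can
    be pushed along the common cone into the other, so they coincide by essential disjointness. *)
Lemma irr_irreducible s : solid s -> irr s -> irreducible Omega (poly s).
Proof.
move=> solids irrs; split; first exact: polyhedral_poly.
move=> D dec; have [ss [ssD Dss]] := decomposition_seq dec.
have DP Q : D Q -> Q `<=` poly s.
  by case: dec => _ _ _ <- DQ; exact: bigcup_sup.
have full t : t \in ss -> rk (poly t) = rk (poly s) ->
    [/\ solid t, poly t `<=` poly s & forall a, perp t a -> perp s a].
  move=> /ssD[solidt Dt] rkt; split=> //; first exact: DP.
  apply/rk_poly_eqP => //; [exact: solid_poly|exact: DP].
have nzss t : t \in ss -> nondegenerate t.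
  by move=> /ssD[[/walled_nondegenerate]].
have cov : covers (poly s) ss.
  move=> x sx; have [_ _ _ DE] := dec; rewrite -DE in sx.
  have [Q DQ Qx] := sx; have [|t tss QE] := Dss Q DQ; first by exists x.
  by exists t => //; rewrite -QE.
have [t tss [_ perpst]] := covers_full_rank solids.2 nzss cov.
have [solidt Dt] := ssD t tss.
have rkt : rk (poly t) = rk (poly s).
  apply/rk_poly_eqP; [exact: solid_poly|exact: DP|].
  by move=> a ta; apply: perpst => u /rcone_cat[_]; exact: ta.
exists (poly t); split=> // Q [DQ rkQ].
have Q0 : Q !=set0.
  apply/set0P/eqP => Q0; have := rk_ge0 (solid_poly solids).
  by rewrite -rkQ Q0 rk_set0.
have [w wss QE] := Dss Q DQ Q0; rewrite {}QE in DQ rkQ Q0 *.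
apply: contrapT => tw; have [_ _ disj _] := dec.
apply: ((ess_disjointP _ _).1 (disj _ _ Dt DQ tw)).
have [solidw ws perpw] := full w wss rkQ.
have [_ ts perpt] := full t tss rkt.
apply/ess_inter_poly; [exact: solidt.1|exact: solidw.1|].
have Et := irr_sub_rcone solids irrs solidt ts perpt.
have wt p : p \in w -> tail_nonneg s p by exact: irr_tail_nonneg perpw.
by have [] := tail_nonneg_cat solidw.1 solidt ts Et wt.
Qed.

End Irreducibility.

(** * Finiteness of images and power sets *)

Section FiniteSets.

(** On [A] the map [G] factors through [F]. Used to bound objects such as linear parts or cosets by
    finitely many data that determine them. *)
Lemma finite_image_factor (S : choiceType) (T U : Type) (A : set S) (F : S -> T)
    (G : S -> U) :
  finite_set (F @` A) -> (forall x y, A x -> A y -> F x = F y -> G x = G y) ->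
  finite_set (G @` A).
Proof.
move=> finF FG; have [->|/set0P[x0 Ax0]] := eqVneq A set0.
  by rewrite image_set0; exact: finite_set0.
pose h z := G (xget x0 [set x | A x /\ F x = z]).
apply: sub_finite_set (finite_image h finF) => _ [x Ax <-].
exists (F x); first by exists x.
apply: FG => //; first by case: xgetP => // y _ [].
by case: xgetP => [y _ []//|/(_ x)[]].
Qed.

Lemma finite_powerset (T : eqType) (B : set T) :
  finite_set B -> finite_set [set X | X `<=` B].
Proof.
move=> /finite_seqP[l ->]; elim: l => [|a l IH].
  by apply: sub_finite_set (finite_set1 set0) => X X0; apply/seteqP; split=> x // /X0.
have : finite_set ([set X | X `<=` [set` l]] `|`
    [set a |` X | X in [set X | X `<=` [set` l]]]).
  by rewrite finite_setU; split=> //; exact: finite_image.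
apply: sub_finite_set => X Xal; have [Xa|Xa] := pselect (X a); [right|left].
  exists (X `&` [set x | x != a]).
    by move=> x [/Xal]; rewrite /= inE => /orP[/eqP ->|//]; rewrite eqxx.
  apply/seteqP; split=> [x [->//|[]//]|x Xx].
  by have [->|xa] := eqVneq x a; [left|right].
move=> x Xx; have := Xal x Xx; rewrite /= inE => /orP[/eqP xa|//].
by rewrite -xa in Xa.
Qed.

End FiniteSets.

(** * Farkas' lemma and boundedness of forms on polyhedra *)

Section Farkas.
Local Open Scope ring_scope.
Context {R : realType} {n : nat}.
Local Notation V := 'rV[R]_n.
Implicit Types (l : seq V) (a c u w : V).

(** Membership in the convex cone generated by [l], the coefficients being peeled off one generator
    at a time. *)
Fixpoint incone l c : Prop :=
  if l is a :: l' then exists2 r : R, 0 <= r & incone l' (c - r *: a) else c = 0.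

(* Induction on the number of generators, eliminating the generator [a0] by
   projecting along a vector [w] with [dot a0 w < 0]. *)
Lemma farkas l c :
  (forall u, (forall a, a \in l -> 0 <= dot a u) -> 0 <= dot c u) -> incone l c.
Proof.
have [m] := ubnP (size l); elim: m l c => // m IH [|a0 l] c /= sl lc.
  apply/eqP; rewrite -dot_eq0 eq_le dot_ge0 andbT -oppr_ge0 -dotNr.
  exact: lc.
have [lc0|] := pselect (forall u, (forall a, a \in l -> 0 <= dot a u) ->
    0 <= dot c u).
  by exists 0 => //; rewrite scale0r subr0; exact: IH.
(* Here [a0] is really needed: [w] is nonnegative against [l] and negative against [c], hence
   negative against [a0]. *)
move=> /existsNP[w /not_implyP[lw /negP]]; rewrite -ltNge => cw.
have aw : dot a0 w < 0.
  rewrite ltNge; apply/negP => aw; have /lc : forall a, a \in a0 :: l -> 0 <= dot a w.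
    by move=> a; rewrite inE => /orP[/eqP ->|/lw].
  by rewrite leNgt cw.
pose k := (dot a0 w)^-1.
have k0 : k < 0 by rewrite invr_lt0.
pose proj a := a - (dot a w * k) *: a0.
have projP a u : dot (proj a) u = dot a (u - (k * dot a0 u) *: w).
  by rewrite /proj dotDl dotNl dotZl dotDr dotNr dotZr; ring.
have : incone (map proj l) (proj c).
  apply: IH; first by rewrite size_map.
  move=> u lu; rewrite projP; apply: lc => a; rewrite inE => /orP[/eqP ->|al].
    rewrite dotDr dotNr dotZr /k; suff -> : (dot a0 w)^-1 * dot a0 u * dot a0 w =
      dot a0 u by rewrite subrr.
    by field; rewrite lt_eqF.
  by rewrite -projP; apply: lu; apply/mapP; exists a.
(* Undoing the projection adds the terms [- r * (dot a w * k)] to the coefficient of [a0]; they are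
   nonnegative because [k < 0 <= dot a w]. *)
have unproj l' c' : {subset l' <= l} -> incone (map proj l') c' ->
    exists2 r : R, 0 <= r & incone l' (c' - r *: a0).
  elim: l' c' => [|a l' IHl] c' l'l /=; first by exists 0; rewrite ?scale0r ?subr0.
  move=> [r r0 /IHl[b bl|r' r'0 l'r]]; first by apply: l'l; rewrite inE bl orbT.
  have al : 0 <= dot a w by apply/lw/l'l; rewrite mem_head.
  exists (r' - r * (dot a w * k)).
    by rewrite subr_ge0 (le_trans _ r'0)// mulr_ge0_le0// mulr_ge0_le0// ltW.
  exists r => //; move: l'r; congr incone; rewrite /proj scalerBr scalerA scalerBl.
  by rewrite !opprB !addrA -!scaleNr; apply/rowP => i; rewrite !mxE; ring.
move=> /unproj[//|r r0 lr]; exists (dot c w * k + r).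
  by rewrite addr_ge0// mulr_le0// ltW.
by move: lr; congr incone; rewrite /proj scalerDl opprD addrA.
Qed.

(** Farkas writes [c] as a nonnegative combination of the normals of [s]; the same combination of
    the offsets is the bound. *)
Lemma poly_bounded_below (s : seq (V * R)) c :
  (forall u, rcone s u -> 0 <= dot c u) ->
  exists B, forall x, poly s x -> B <= dot c x.
Proof.
move=> sc; have : incone (map fst s) c.
  apply: farkas => u su; apply: sc => p ps; apply: su.
  by apply/mapP; exists p.
elim: s c {sc} => [c ->|p s IH c [r r0 /IH[B sB]]].
  by exists 0 => x _; rewrite dot0l.
exists (B + r * p.2) => x spx.
have sx : poly s x by move=> q qs; apply: spx; rewrite inE qs orbT.
have px : 0 <= slack p x by apply: spx; rewrite mem_head.
have := sB x sx; rewrite dotDl dotNl dotZl; move: px; rewrite /slack.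
nra.
Qed.

End Farkas.

(** * Cutting a polyhedral set by finitely many walls *)

Section Walls.
Local Open Scope ring_scope.
Context {R : realType} {n : nat}.
Local Notation V := 'rV[R]_n.
Variable Omega : set (set V).
Implicit Types (s t c l q : seq (V * R)) (p : V * R) (a u v x : V).

Lemma hyperplane_point a b : a != 0 -> hyperplane a b ((b / dot a a) *: a).
Proof. by move=> a0; rewrite /hyperplane /= dotZr divfK// dot_eq0. Qed.

Lemma hyperplane_inj a a' b b' : a != 0 -> a' != 0 ->
  hyperplane a b = hyperplane a' b' ->
  exists2 r, r != 0 & a = r *: a' /\ b = r * b'.
Proof.
move=> a0 a'0 E; pose x := (b / dot a a) *: a; pose r := dot a' a / dot a' a'.
have ax : dot a x = b := hyperplane_point b a0.
have a'x : dot a' x = b'.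
  by have : hyperplane a b x := ax; rewrite E.
have d' : dot a' a' != 0 by rewrite dot_eq0.
have aE : a = r *: a'.
  have [//|v0] := eqVneq a (r *: a').
  (* The component of [a] orthogonal to [a']: moving [x] by it stays on the second hyperplane, hence
     on the first, which forces [dot v v = 0]. *)
  pose v := a - r *: a'.
  have a'v : dot a' v = 0 by rewrite /v dotDr dotNr dotZr divfK// subrr.
  have : hyperplane a' b' (x + v) by rewrite /hyperplane /= dotDr a'x a'v addr0.
  rewrite -E /hyperplane /= dotDr ax => /eqP; rewrite -subr_eq0 addrAC subrr add0r.
  have -> : dot a v = dot v v by rewrite [in RHS]/v dotDl dotNl dotZl a'v mulr0 subr0.
  by rewrite dot_eq0 subr_eq0 (negbTE v0).
exists r; first by apply: contraNneq a0 => r0; rewrite aE r0 scale0r.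
by split=> //; rewrite -ax -a'x [in LHS]aE dotZl.
Qed.

Lemma slackZ r a b x : slack (r *: a, r * b) x = r * slack (a, b) x.
Proof. by rewrite /slack dotZl mulrBr. Qed.

Lemma finite_normals : finitely_many_parallel_families Omega ->
  exists l : seq V, forall p, wall Omega p -> exists2 a, a \in l &
    exists2 r, r != 0 & exists b, p = (r *: a, r * b) /\ wall Omega (a, b).
Proof.
move=> [F [/finite_seqP[FF ->] FP OE]].
suff [l lP] : exists l : seq V, forall A, A \in FF -> exists2 a, a \in l &
    a != 0 /\ forall H, A H -> exists b, H = hyperplane a b.
  exists l => -[a b] [/= a0 Oab].
  have [A AF Aab] : exists2 A, A \in FF & A (hyperplane a b).
    by move: Oab; rewrite OE => -[A AF Aab]; exists A.
  have [a' a'l [a'0 /(_ _ Aab)[b' E]]] := lP A AF.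
  have [r r0 [-> ->]] := hyperplane_inj a0 a'0 E.
  by exists a' => //; exists r => //; exists b'; split=> //; split; rewrite //= -E.
elim: FF FP {OE} => [_|A FF IH FP]; first by exists [::].
have [|l lP] := IH; first by move=> B BF; apply: FP; rewrite /= inE BF orbT.
have [a a0 aA] := FP A (mem_head _ _).
exists (a :: l) => B; rewrite inE => /orP[/eqP ->|/lP[b bl bB]].
  by exists a => //; rewrite mem_head.
by exists b => //; rewrite inE bl orbT.
Qed.

(** The hyperplane with offset [b] meets the line spanned by [a] at [psi b], so local finiteness
    along that line becomes local finiteness of the offsets, and the segment is compact. *)
Lemma finite_parallel_walls a (B1 B2 : R) : locally_finite_arrangement Omega ->
  a != 0 -> finite_set [set b | Omega (hyperplane a b) /\ B1 <= b <= B2].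
Proof.
move=> lfin a0; pose psi (b : R) := (b / dot a a) *: a.
have cpsi (b : R) : {for b, continuous psi}.
  apply: cvgZr_tmp; apply: cvgM; [exact: cvg_id|exact: cvg_cst].
have loc (b : R) : exists N : set R, [/\ open N, N b &
    finite_set [set b | Omega (hyperplane a b) /\ N b]].
  have [U Ux finU] := lfin (psi b).
  have : nbhs b (psi @^-1` U) by exact: cpsi.
  rewrite nbhsE => -[N [oN Nb] NU]; exists N; split=> //.
  rewrite -[X in finite_set X]image_id.
  apply: (finite_image_factor (F := hyperplane a)) => [|c d _ _ E]; last first.
    have [r _ [ar ->]] := hyperplane_inj a0 a0 E.
    suff -> : r = 1 by rewrite mul1r.
    have /eqP := ar; rewrite -subr_eq0 -[X in X - _]scale1r -scalerBl scaler_eq0.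
    by rewrite (negbTE a0) orbF subr_eq0 => /eqP.
  apply: sub_finite_set finU => _ [c [Oc Nc] <-]; split=> //.
  by exists (psi c); split; [exact: hyperplane_point|exact: NU].
have [N NP] := choice loc.
have : cover_compact `[B1, B2] by rewrite -compact_cover; exact: segment_compact.
move=> /(_ _ setT N)[b _|b _|D _ cov].
- by have [] := NP b.
- by exists b => //; have [] := NP b.
move: cov (finite_fset D); set E := (X in cover X N) => cov finE.
have finB : finite_set
    (\bigcup_(b in E) [set c | Omega (hyperplane a c) /\ N b c]).
  by apply: bigcup_finite => // b _; have [] := NP b.
apply: sub_finite_set finB => b [Ob bB].
have [|d Dd Ndb] := cov b; first by rewrite /= in_itv.
by exists d.
Qed.

Definition opp_form p : V * R := (- p.1, - p.2).

(** All choices of a side for each form of [l], including those whose region is empty. *)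
Fixpoint cells l : seq (seq (V * R)) :=
  if l is p :: l' then
    [seq p :: c | c <- cells l'] ++ [seq opp_form p :: c | c <- cells l']
  else [:: [::]].

Lemma cells_cover l A : covers A (cells l).
Proof.
move=> x _; elim: l => [|p l [c cl cx]] /=; first by exists [::].
have [px|px] := leP 0 (slack p x).
  exists (p :: c); first by rewrite mem_cat map_f.
  by move=> q; rewrite inE => /orP[/eqP ->|/cx].
exists (opp_form p :: c).
  by rewrite mem_cat orbC; apply/orP; left; apply: map_f.
move=> q; rewrite inE => /orP[/eqP ->|/cx//].
by rewrite slackN oppr_ge0 ltW.
Qed.

Lemma cells_walled l c : walled Omega l -> c \in cells l -> walled Omega c.
Proof.
elim: l c => [|p l IH] c wl /=; first by rewrite inE => /eqP ->.
have wl' : walled Omega l by move=> q ql; apply: wl; rewrite inE ql orbT.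
have wp : wall Omega p by apply: wl; rewrite mem_head.
rewrite mem_cat => /orP[]/mapP[d /(IH _ wl') wd -> q]; rewrite inE.
  by move=> /orP[/eqP ->|/wd].
by move=> /orP[/eqP ->|/wd//]; exact: wallN.
Qed.

Lemma cells_sign l c p : c \in cells l -> p \in l -> p \in c \/ opp_form p \in c.
Proof.
elim: l c => [//|q l IH] c /=.
rewrite mem_cat inE => /orP[]/mapP[d dl ->] /orP[/eqP ->|pl].
- by left; rewrite mem_head.
- by have [pd|pd] := IH d dl pl; [left|right]; rewrite inE pd orbT.
- by right; rewrite mem_head.
- by have [pd|pd] := IH d dl pl; [left|right]; rewrite inE pd orbT.
Qed.

(* Finitely many walls suffice to cut [poly s] into irreducible pieces and
   pieces of lower rank: all the walls with normal [a] orthogonal to the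
   recession cone, which are bounded on [poly s] by Farkas' lemma, and one wall
   of every other family. *)
Lemma cutting_walls s : finitely_many_parallel_families Omega ->
    locally_finite_arrangement Omega -> poly s !=set0 ->
  exists2 l, walled Omega l & forall c, c \in cells l ->
    (forall a, perp (s ++ c) a -> perp s a) -> irr Omega (s ++ c).
Proof.
move=> fam lfin s0; have [N NP] := finite_normals fam.
pose good l a :=
  (perp s a -> forall b, wall Omega (a, b) ->
    (exists2 x, poly s x & slack (a, b) x < 0) ->
    (exists2 x, poly s x & 0 < slack (a, b) x) -> (a, b) \in l) /\
  (~ perp s a -> forall b, wall Omega (a, b) -> exists b', (a, b') \in l).
have [l wl lN] : exists2 l, walled Omega l & forall a, a \in N -> good l a.
  elim: (N) => [|a N' [l wl lN']]; first by exists [::].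
  suff [l' wl' l'a] : exists2 l', walled Omega l' & good l' a.
    exists (l' ++ l) => [|a']; first by apply/walled_cat.
    rewrite inE => /orP[/eqP ->|/lN'[G1 G2]]; case: l'a => G1' G2'; split.
    - by move=> ? ? ? ? ?; rewrite mem_cat G1'.
    - by move=> /G2' H b /H[b' bl]; exists b'; rewrite mem_cat bl.
    - by move=> ? ? ? ? ?; rewrite mem_cat G1 ?orbT.
    - by move=> /G2 H b /H[b' bl]; exists b'; rewrite mem_cat bl orbT.
  have [pa|pa] := pselect (perp s a); last first.
    have [[b wab]|nw] := pselect (exists b, wall Omega (a, b)).
      exists [:: (a, b)]; first exact/walled1.
      by split=> // _ c _; exists b; rewrite mem_head.
    by exists [::] => //; split=> // _ b wab; case: nw; exists b.
  have [a0|a0] := eqVneq a 0.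
    by exists [::] => //; split=> // _ b []; rewrite a0 eqxx.
  (* Both [a] and [- a] vanish on the recession cone, so both are bounded below on [poly s]; a wall
     cutting it has its offset between [B1] and [- B2]. *)
  have [B1 sB1] : exists B, forall x, poly s x -> B <= dot a x.
    by apply: poly_bounded_below => u /pa ->.
  have [B2 sB2] : exists B, forall x, poly s x -> B <= dot (- a) x.
    by apply: poly_bounded_below => u /pa; rewrite dotNl => ->; rewrite oppr0.
  have /finite_seqP[bs bsE] := finite_parallel_walls B1 (- B2) lfin a0.
  have bsP b : b \in bs <-> Omega (hyperplane a b) /\ B1 <= b <= - B2.
    by have := congr1 (@^~ b) bsE => /= ->.
  exists [seq (a, b) | b <- bs] => [p /mapP[b /bsP[Ob _] ->] //|].
  split=> // _ b [_ Ob] [x sx xb] [y sy yb]; apply/mapP; exists b => //.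
  apply/bsP; split=> //; have := sB1 x sx; have := sB2 y sy.
  by move: xb yb; rewrite /slack /= dotNl; lra.
exists l => // c cl perpc p wp [x scx px] [y scy py].
have [a aN [r r0 [b [pE wab]]]] := NP p wp.
rewrite {}pE /= in px py *; have [good1 good2] := lN a aN.
have sx : poly s x by case/poly_cat : scx.
have sy : poly s y by case/poly_cat : scy.
(* Otherwise [a] would be orthogonal to the cone of [s] too, the cutting wall itself would be in
   [l], and the cell would lie on one side of it, unlike [x] and [y]. *)
have np : ~ perp (s ++ c) (r *: a).
  move=> /perpc pa; have {}pa : perp s a.
    by move=> u /pa /eqP; rewrite dotZl mulf_eq0 (negbTE r0) => /eqP.
  have abl : (a, b) \in l.
    move: px py; rewrite !slackZ; move: r0; rewrite neq_lt => /orP[]r0.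
      rewrite nmulr_rlt0// nmulr_rgt0// => xa ya.
      by apply: good1 => //; [exists y|exists x].
    rewrite pmulr_rlt0// pmulr_rgt0// => xa ya.
    by apply: good1 => //; [exists x|exists y].
  have /poly_cat[_ cx] := scx; have /poly_cat[_ cy] := scy.
  have [abc|abc] := cells_sign cl abl.
    have := cx _ abc; have := cy _ abc; move: px py; rewrite !slackZ.
    by move: r0; rewrite neq_lt => /orP[]; nra.
  have := cx _ abc; have := cy _ abc; rewrite !slackN; move: px py; rewrite !slackZ.
  by move: r0; rewrite neq_lt => /orP[]; nra.
split=> //.
have npa : ~ perp s a.
  move=> pa; apply: np => u /rcone_cat[/pa au _].
  by rewrite dotZl au mulr0.
(* One wall of [l] parallel to the given one already fixes the sign of [a] on the cone of the cell;
   the sign of [r] transfers it to [r *: a]. *)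
have [b' ab'l] := good2 npa b wab.
have dotr u : dot (r *: a) u = r * dot a u by rewrite dotZl.
have [abc|abc] := cells_sign cl ab'l.
  have ca u : rcone (s ++ c) u -> 0 <= dot a u.
    by move=> /rcone_cat[_ cu]; exact: cu _ abc.
  move: r0; rewrite neq_lt => /orP[]r0; [right|left] => u /ca; rewrite dotr.
    by rewrite nmulr_rle0.
  by rewrite pmulr_rge0.
have ca u : rcone (s ++ c) u -> dot a u <= 0.
  by move=> /rcone_cat[_ cu]; have := cu _ abc; rewrite dotNl oppr_ge0.
move: r0; rewrite neq_lt => /orP[]r0; [left|right] => u /ca; rewrite dotr.
  by rewrite nmulr_rge0.
by rewrite pmulr_rle0.
Qed.

(** The pieces are the cells of full rank. The second clause says that every full-rank subset meets
    one of them in full rank; it bounds the number of germs of top rank inside [poly s]. *)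
Lemma finite_irreducible_pieces s : finitely_many_parallel_families Omega ->
    locally_finite_arrangement Omega -> solid Omega s ->
  exists ts : seq (seq (V * R)),
    (forall t, t \in ts -> [/\ solid Omega t, irr Omega t, poly t `<=` poly s &
      rk (poly t) = rk (poly s)]) /\
    (forall q, solid Omega q -> poly q `<=` poly s ->
      (forall a, perp q a -> perp s a) ->
      exists2 t, t \in ts & spoly (q ++ t) !=set0 /\
        forall a, perp (q ++ t) a -> perp s a).
Proof.
move=> fam lfin solids.
have [l wl lP] := cutting_walls fam lfin (solid_poly solids).
pose full t := `[< spoly t !=set0 /\ forall a, perp t a -> perp s a >].
exists [seq t <- [seq s ++ c | c <- cells l] | full t]; split=> [t|q solidq qs qperp].
  rewrite mem_filter => /andP[/asboolP[t0 tperp] /mapP[c cl tE]].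
  rewrite {}tE in t0 tperp *.
  have solidsc : solid Omega (s ++ c).
    by split=> //; apply/walled_cat; split; [exact: solids.1|exact: cells_walled cl].
  have sub : poly (s ++ c) `<=` poly s by move=> x /poly_cat[].
  split=> //; first exact: lP.
  by apply/rk_poly_eqP => //; exact: solid_poly solidsc.
have [|||c cl [[x qcx] qcperp]] := @covers_full_rank _ _ q (cells l).
- exact: solidq.2.
- by move=> c cl; apply: walled_nondegenerate; exact: cells_walled wl cl.
- exact: cells_cover.
have /spoly_cat[qx cx] := qcx.
have sx : spoly s x.
  move=> p ps; apply: (solid_sub_strict solidq (solids.1 p ps)) => // y /qs.
  exact.
have q0 : poly q !=set0 by exact: solid_poly solidq.
have tperp a : perp (s ++ c) a -> perp q a.
  move=> sca; apply: qcperp => u /rcone_cat[qu cu]; apply: sca.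
  by apply/rcone_cat; split=> //; exact: sub_rcone qs _ qu.
exists (s ++ c); last first.
  split; first by exists x; apply/spoly_cat; split=> //; apply/spoly_cat.
  move=> a qsca; apply/qperp/qcperp => u /rcone_cat[qu cu]; apply: qsca.
  apply/rcone_cat; split=> //; apply/rcone_cat; split=> //.
  exact: sub_rcone qs _ qu.
rewrite mem_filter; apply/andP; split; last by apply/mapP; exists c.
apply/asboolP; split; first by exists x; apply/spoly_cat.
by move=> a /tperp/qperp.
Qed.

End Walls.

(** * Euclidean isometries and their linear parts *)

Section Isometries.
Local Open Scope ring_scope.
Context {R : realType} {n : nat}.
Local Notation V := 'rV[R]_n.
Implicit Types (g h : bijection V) (s : seq (V * R)) (p : V * R) (u v x y a : V).

Lemma bijME g h x : (g * h)%g x = h (g x).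
Proof. by []. Qed.

Lemma bijVK g x : g^-1%g (g x) = x.
Proof. exact: bij_funK. Qed.

Lemma bijKV g x : g (g^-1%g x) = x.
Proof. exact: bij_invK. Qed.

Lemma image_bijM g h (H : set V) : (g * h)%g @` H = h @` (g @` H).
Proof. by rewrite image_comp. Qed.

Lemma image_bijVK g (H : set V) : g^-1%g @` (g @` H) = H.
Proof. by rewrite -image_bijM mulgV image_id. Qed.

Lemma dot_sub u v : dot (u - v) (u - v) = dot u u - dot u v *+ 2 + dot v v.
Proof. by rewrite dotDl !dotDr !dotNl !dotNr (dotC v u); ring. Qed.

Lemma euclidean_isometryP g : euclidean_isometry g <->
  forall x y, dot (g x - g y) (g x - g y) = dot (x - y) (x - y).
Proof.
split=> gP x y; last by rewrite /enorm gP.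
by rewrite -[LHS]sqr_sqrtr ?dot_ge0// -[RHS]sqr_sqrtr ?dot_ge0// -!/(enorm _) gP.
Qed.

Lemma euclidean_isometryV g : euclidean_isometry g -> euclidean_isometry g^-1%g.
Proof. by move=> gP x y; rewrite -gP !bijKV. Qed.

Lemma euclidean_isometryM g h :
  euclidean_isometry g -> euclidean_isometry h -> euclidean_isometry (g * h)%g.
Proof. by move=> gP hP x y; rewrite !bijME hP gP. Qed.

Section OneIsometry.
Variable g : bijection V.
Hypothesis g_iso : euclidean_isometry g.
Local Notation phi := (linear_part g).

Lemma linear_part_dot u v : dot (phi u) (phi v) = dot u v.
Proof.
have gP := (euclidean_isometryP g).1 g_iso.
have := gP u v; have := gP u 0; have := gP v 0; rewrite !subr0.
have -> : g u - g v = phi u - phi v by rewrite /linear_part opprB addrA subrK.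
by rewrite -/(phi u) -/(phi v) !dot_sub; lra.
Qed.

(** The square of the defect expands into inner products, all of which [phi] preserves, so it
    vanishes as it does for the identity. *)
Lemma linear_part_affine u v r : phi (u + r *: v) = phi u + r *: phi v.
Proof.
apply/eqP; rewrite -subr_eq0 -dot_eq0; apply/eqP; set w := u + r *: v.
have := (linear_part_dot w w, linear_part_dot w u, linear_part_dot w v,
  linear_part_dot u u, linear_part_dot u v, linear_part_dot v v).
move: (phi w) (phi u) (phi v) => w' u' v' dots.
rewrite dot_sub !(dotDl, dotDr, dotZl, dotZr) (dotC v' u') !dots /w.
by rewrite !(dotDl, dotDr, dotZl, dotZr) (dotC v u); ring.
Qed.

Lemma linear_part0 : phi 0 = 0.
Proof. by rewrite /linear_part subrr. Qed.

Lemma linear_partZ r v : phi (r *: v) = r *: phi v.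
Proof. by have := linear_part_affine 0 v r; rewrite linear_part0 !add0r. Qed.

Lemma linear_partD u v : phi (u + v) = phi u + phi v.
Proof. by have := linear_part_affine u v 1; rewrite !scale1r. Qed.

Lemma linear_partB u v : phi (u - v) = phi u - phi v.
Proof. by have := linear_part_affine u v (- 1); rewrite !scaleN1r. Qed.

Lemma isometryE x : g x = phi x + g 0.
Proof. by rewrite /linear_part subrK. Qed.

Lemma isometryD x u : g (x + u) = g x + phi u.
Proof. by rewrite isometryE linear_partD addrAC -isometryE. Qed.

Lemma linear_part_eq0 u : (phi u == 0) = (u == 0).
Proof. by rewrite -dot_eq0 linear_part_dot dot_eq0. Qed.

Lemma linear_part_mx : exists Phi : 'M[R]_n, forall u, phi u = u *m Phi.
Proof.
exists (\matrix_(i < n) phi (row i 1%:M)) => u.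
rewrite mulmx_sum_row -[in LHS](mulmx1 u) mulmx_sum_row.
rewrite (big_morph phi linear_partD linear_part0); apply: eq_bigr => i _.
by rewrite linear_partZ rowK.
Qed.

End OneIsometry.

Lemma linear_partM g h u : euclidean_isometry h ->
  linear_part (g * h)%g u = linear_part h (linear_part g u).
Proof.
move=> hP; rewrite [X in linear_part h X]/linear_part linear_partB//.
by rewrite /linear_part !bijME opprB addrA subrK.
Qed.

Lemma linear_partVK g u : euclidean_isometry g ->
  linear_part g^-1%g (linear_part g u) = u.
Proof.
move=> gP; rewrite -linear_partM; last exact: euclidean_isometryV.
by rewrite mulgV /linear_part subr0.
Qed.

Lemma linear_partKV g u : euclidean_isometry g ->
  linear_part g (linear_part g^-1%g u) = u.
Proof. by move=> gP; rewrite -linear_partM// mulVg /linear_part subr0. Qed.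

Lemma linear_part_unitmx g : euclidean_isometry g ->
  exists2 Phi : 'M[R]_n, Phi \in unitmx & forall u, linear_part g u = u *m Phi.
Proof.
move=> gP; have [Phi PhiP] := linear_part_mx gP.
have [Psi PsiP] := linear_part_mx (euclidean_isometryV gP).
exists Phi => //; have /mulmx1_unit[//] : Phi *m Psi = 1%:M.
apply/row_matrixP => i; rewrite row_mul -[in LHS](mul1mx Phi) row_mul.
by rewrite -PhiP -PsiP linear_partVK.
Qed.

(** Both maps are affine, and every [y] is reached from [x] by scaling up a small step inside the
    strict set. *)
Lemma isometry_eq g h s : euclidean_isometry g -> euclidean_isometry h ->
  spoly s !=set0 -> (forall x, spoly s x -> g x = h x) -> g = h.
Proof.
move=> gP hP [x sx] gh; apply: bijP => y.
have [t [t0 /gh]] := near_ex2 (nbhs_right_gt 0) (spoly_near (y - x) sx).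
rewrite !isometryD// !linear_partZ// gh// => /addrI /scalerI.
by rewrite gt_eqF// => /(_ isT) E; rewrite -(subrK x y) addrC !isometryD// gh// E.
Qed.

(** The form carried along by [g], so that slacks are preserved; the offset comes from expanding the
    inner product with [g x]. *)
Definition form_image g p : V * R :=
  (linear_part g p.1, p.2 + dot (linear_part g p.1) (g 0)).

Definition forms_image g s := map (form_image g) s.

Lemma slack_image g p x : euclidean_isometry g ->
  slack (form_image g p) (g x) = slack p x.
Proof.
by move=> gP; rewrite /slack/= (isometryE g x) dotDr linear_part_dot//; ring.
Qed.

Lemma poly_image_iff g s x : euclidean_isometry g ->
  poly (forms_image g s) (g x) <-> poly s x.
Proof.
move=> gP; split=> sx p; last by move=> /mapP[q qs ->]; rewrite slack_image//; exact: sx.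
by move=> ps; rewrite -(slack_image p x gP); apply: sx; exact: map_f.
Qed.

Lemma spoly_image_iff g s x : euclidean_isometry g ->
  spoly (forms_image g s) (g x) <-> spoly s x.
Proof.
move=> gP; split=> sx p; last by move=> /mapP[q qs ->]; rewrite slack_image//; exact: sx.
by move=> ps; rewrite -(slack_image p x gP); apply: sx; exact: map_f.
Qed.

Lemma rcone_image_iff g s u : euclidean_isometry g ->
  rcone (forms_image g s) (linear_part g u) <-> rcone s u.
Proof.
move=> gP; split=> su p.
  move=> ps; have := su (form_image g p) (map_f _ ps).
  by rewrite linear_part_dot.
by move=> /mapP[q qs ->]; rewrite linear_part_dot//; exact: su.
Qed.

Lemma poly_image g s : euclidean_isometry g ->
  g @` poly s = poly (forms_image g s).
Proof.
move=> gP; apply/seteqP; split=> [_ [x sx <-]|y]; first exact/poly_image_iff.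
by rewrite -(bijKV g y) => /poly_image_iff-/(_ gP) sy; exists (g^-1%g y).
Qed.

Lemma rk_image g s : euclidean_isometry g -> poly s !=set0 ->
  rk (poly (forms_image g s)) = rk (poly s).
Proof.
suff le (h : bijection V) t : euclidean_isometry h -> poly t !=set0 ->
    rk (poly t) <= rk (h @` poly t).
  move=> gP s0; have gs0 : poly (forms_image g s) !=set0.
    by case: s0 => x sx; exists (g x); exact/poly_image_iff.
  apply/eqP; rewrite eq_le -poly_image// le// andbT.
  rewrite poly_image// (le_trans (le _ _ (euclidean_isometryV gP) gs0))//.
  by rewrite -poly_image// image_bijVK.
move=> hP t0; have [Phi PhiU PhiP] := linear_part_unitmx hP.
have ht0 : poly (forms_image h t) !=set0.
  by case: t0 => x sx; exists (h x); exact/poly_image_iff.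
rewrite poly_image//; apply: (rk_le_linear PhiU) => // u.
move=> /(limit_set_poly _ t0)[u1 tu]; apply/limit_set_poly => //.
rewrite -PhiP; split; last exact/rcone_image_iff.
by rewrite -u1 /enorm linear_part_dot.
Qed.

End Isometries.

(** * Isometries preserving the arrangement *)

Section IsomGroup.
Local Open Scope ring_scope.
Context {R : realType} {n : nat}.
Local Notation V := 'rV[R]_n.
Variable Omega : set (set V).
Implicit Types (g h : bijection V) (s : seq (V * R)) (p : V * R) (u v x y a : V).
Local Notation Isom := (Isom Omega).

Lemma Isom1 : Isom 1%g.
Proof.
split=> //; apply/seteqP; split=> [_ [H OH <-]|H OH]; first by rewrite image_id.
by exists H => //; rewrite image_id.
Qed.

Lemma IsomV g : Isom g -> Isom g^-1%g.
Proof.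
move=> [gP gO]; split; first exact: euclidean_isometryV.
apply/seteqP; split=> [_ [H + <-]|H OH].
  by rewrite -[in Omega _]gO => -[H' OH' <-]; rewrite image_bijVK.
exists (g @` H); last exact: image_bijVK.
by rewrite -[X in X _]gO; exists H.
Qed.

Lemma IsomM g h : Isom g -> Isom h -> Isom (g * h)%g.
Proof.
move=> [gP gO] [hP hO]; split; first exact: euclidean_isometryM.
apply/seteqP; split=> [_ [H OH <-]|H].
  rewrite image_bijM -[X in X _]hO; exists (g @` H) => //.
  by rewrite -[X in X _]gO; exists H.
rewrite -[X in X _ -> _]hO => -[H' + <-]; rewrite -[X in X _ -> _]gO => -[H'' OH'' <-].
by exists H'' => //; rewrite image_bijM.
Qed.

Lemma wall_image g p : Isom g -> wall Omega p -> wall Omega (form_image g p).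
Proof.
move=> [gP gO] [p0 Op]; split; first by rewrite /= linear_part_eq0.
rewrite -[X in X _]gO; exists (hyperplane p.1 p.2) => //.
have E x : hyperplane (form_image g p).1 (form_image g p).2 (g x) <->
    hyperplane p.1 p.2 x.
  have := slack_image p x gP; rewrite /slack /hyperplane /= => E.
  split=> [/eqP|/eqP]; rewrite -subr_eq0.
    by rewrite E subr_eq0 => /eqP.
  by rewrite -E subr_eq0 => /eqP.
apply/seteqP; split=> [_ [x px <-]|y]; first exact/E.
by rewrite -(bijKV g y) => /E py; exists (g^-1%g y).
Qed.

Lemma walled_image g s : Isom g -> walled Omega s -> walled Omega (forms_image g s).
Proof. by move=> gI ws _ /mapP[p /ws wp ->]; exact: wall_image. Qed.

Lemma solid_image g s : Isom g -> solid Omega s -> solid Omega (forms_image g s).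
Proof.
move=> gI [ws [x sx]]; split; first exact: walled_image.
by exists (g x); apply/spoly_image_iff => //; exact: gI.1.
Qed.

Lemma irr_image g s : Isom g -> irr Omega s -> irr Omega (forms_image g s).
Proof.
move=> gI irrs p wp [x sx px] [y sy py].
have gVI := IsomV gI; have [gP _] := gI; have [gVP _] := gVI.
pose p' := form_image g^-1%g p.
have p'E z : slack p' (g^-1%g z) = slack p z by exact: slack_image.
have p'1 u : dot p'.1 (linear_part g^-1%g u) = dot p.1 u by exact: linear_part_dot.
have [|||sgn np] := irrs p'.
- exact: wall_image.
- exists (g^-1%g x); last by rewrite p'E.
  by apply/(poly_image_iff s _ gP); rewrite bijKV.
- exists (g^-1%g y); last by rewrite p'E.
  by apply/(poly_image_iff s _ gP); rewrite bijKV.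
have back u : rcone (forms_image g s) u -> rcone s (linear_part g^-1%g u).
  by move=> su; apply/(rcone_image_iff s _ gP); rewrite linear_partKV.
split.
  by case: sgn => sgn; [left|right] => u /back /sgn; rewrite p'1.
move=> sp; apply: np => u su; rewrite -(linear_partVK u gP) p'1.
exact/sp/rcone_image_iff.
Qed.

Definition translation v : bijection V := Bijection (addrK v) (subrK v).

Lemma Omega_wall H : finitely_many_parallel_families Omega -> Omega H ->
  exists2 p, wall Omega p & H = hyperplane p.1 p.2.
Proof.
move=> [F [_ FP OE]] OH.
have [A FA AH] : exists2 A, F A & A H by move: OH; rewrite OE => -[A]; exists A.
have [a a0 /(_ _ AH)[b HE]] := FP A FA.
by exists (a, b) => //; split; rewrite //= -HE.
Qed.

(* Otherwise all the translations along [u] would preserve [Omega]. *)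
Lemma wall_normals_span u : finitely_many_parallel_families Omega ->
  Isom_properly_discontinuous Omega ->
  (forall p, wall Omega p -> dot p.1 u = 0) -> u = 0.
Proof.
move=> fam hpd pu; apply/eqP/negPn/negP => u0.
(* The segment from 0 to [u]: each of the infinitely many translations by [u] divided by [k.+1]
   sends its endpoint 0 back into it. *)
pose K : set V := [set r *: u | r in `[(0:R), 1]%classic].
have cK : compact K.
  apply: continuous_compact; last exact: segment_compact.
  by apply: continuous_subspaceT => r; apply: cvgZr_tmp; exact: cvg_id.
have tH r H : Omega H -> translation (r *: u) @` H = H.
  move=> /(Omega_wall fam)[p /pu pu0 ->].
  have shift c x : hyperplane p.1 p.2 x -> hyperplane p.1 p.2 (x + c *: u).
    by rewrite /hyperplane /= dotDr dotZr pu0 mulr0 addr0.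
  apply/seteqP; split=> [_ [x Hx <-]|x Hx]; first exact: shift.
  by exists (x + (- r) *: u); [exact: shift|rewrite /= scaleNr subrK].
have tI r : Isom (translation (r *: u)).
  split=> [x y|]; first by rewrite /= opprD addrACA subrr addr0.
  apply/seteqP; split=> [_ [H OH <-]|H OH]; first by rewrite tH.
  by exists H => //; exact: tH.
pose w (k : nat) : V := (k.+1%:R^-1 : R) *: u.
have : finite_set (w @` setT).
  apply: sub_finite_set (finite_image (fun g : bijection V => g 0) (hpd K cK)).
  move=> _ [k _ <-]; exists (translation (w k)); last by rewrite /= add0r.
  split; first exact: tI.
  exists (w k); split; last first.
    by exists k.+1%:R^-1; rewrite //= in_itv/= invr_ge0 ler0n invf_le1// ler1n.
  exists 0; last by rewrite /= add0r.
  by exists 0; rewrite ?scale0r//= in_itv/= lexx ler01.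
move=> finw; apply: infinite_nat; rewrite -[X in finite_set X]image_id.
apply: (finite_image_factor finw) => j k _ _ /eqP.
rewrite -subr_eq0 -scalerBl scaler_eq0 (negbTE u0) orbF subr_eq0.
by move=> /eqP/invr_inj/eqP; rewrite eqr_nat => /eqP[].
Qed.

(** Unit normals of walls go to unit normals of walls, of which there are finitely many up to sign,
    and they determine the linear part because they span. *)
Lemma finite_linear_parts : finitely_many_parallel_families Omega ->
  Isom_properly_discontinuous Omega ->
  finite_set [set linear_part g | g in Isom].
Proof.
move=> fam hpd; have [N NP] := finite_normals fam.
pose nrm a := (enorm a)^-1 *: a.
pose U := [seq nrm a | a <- N] ++ [seq - nrm a | a <- N].
have UP g p : Isom g -> wall Omega p -> linear_part g (nrm p.1) \in U.
  move=> gI wp; have [gP _] := gI; have [p0 _] := wp.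
  have [a aN [r r0 [b [gpE _]]]] := NP _ (wall_image gI wp).
  have a0 : a != 0.
    have := linear_part_eq0 gP p.1; have [-> _] := gpE.
    by rewrite scaler_eq0 (negbTE r0) (negbTE p0) /= => ->.
  have e0 := enorm_gt0 p0; have ea0 := enorm_gt0 a0.
  pose c := (enorm p.1)^-1 * r * enorm a.
  have E : linear_part g (nrm p.1) = c *: nrm a.
    rewrite /nrm linear_partZ//; have [-> _] := gpE.
    by rewrite !scalerA; congr (_ *: _); rewrite /c; field; rewrite !gt_eqF.
  have c1 : c ^+ 2 = 1.
    have : dot (linear_part g (nrm p.1)) (linear_part g (nrm p.1)) = 1.
      by rewrite linear_part_dot//; apply/eqP; rewrite -enorm_eq1 enorm_normalize.
    have /eqP := enorm_normalize a0; rewrite enorm_eq1 => /eqP na1.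
    by rewrite E dotZl dotZr na1 mulr1 -expr2.
  rewrite E mem_cat; move/eqP: c1; rewrite sqrf_eq1 => /orP[]/eqP ->.
    by rewrite scale1r map_f.
  by rewrite scaleN1r (map_f (fun a => - nrm a)) ?orbT.
pose F g : set (V * V) :=
  [set z | exists2 p, wall Omega p & z = (nrm p.1, linear_part g (nrm p.1))].
apply: (finite_image_factor (F := F)).
  have : finite_set ([set` U] `*` [set` U]) by apply: finite_setX; exact: finite_seq.
  move=> /finite_powerset; apply: sub_finite_set => _ [g gI <-] _ [p wp ->].
  split; last exact: UP.
  have := UP _ _ Isom1 wp.
  by rewrite /linear_part /= subr0.
move=> g h gI hI FE; have [gP _] := gI; have [hP _] := hI.
have gh p : wall Omega p -> linear_part g p.1 = linear_part h p.1.
  move=> wp; have [p0 _] := wp.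
  have : F h (nrm p.1, linear_part g (nrm p.1)) by rewrite -FE; exists p.
  move=> [q wq [E1 E2]].
  have : linear_part g (nrm p.1) = linear_part h (nrm p.1) by rewrite E2 E1.
  rewrite /nrm !linear_partZ// => /scalerI; apply.
  by rewrite invr_eq0 gt_eqF// enorm_gt0.
apply/funext => v; apply/eqP; rewrite -subr_eq0.
set w := linear_part g v - linear_part h v.
suff : linear_part g^-1%g w = 0.
  move/eqP; rewrite linear_part_eq0//; exact: euclidean_isometryV.
apply: wall_normals_span => // p wp.
rewrite -(linear_part_dot gP) linear_partKV// /w dotDr dotNr.
by rewrite linear_part_dot// gh// linear_part_dot// subrr.
Qed.

End IsomGroup.

(** * Germs, and the isometry by which a map acts on a germ *)

Section Germs.
Local Open Scope ring_scope.
Context {R : realType} {n : nat}.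
Local Notation V := 'rV[R]_n.
Variable Omega : set (set V).
Implicit Types (f g h : bijection V) (s t q : seq (V * R)) (p : V * R).
Implicit Types (P Q : set V) (gamma : set (set V)) (u v x y a : V).
Local Notation Isom := (Isom Omega).
Local Notation germ := (germ Omega).
Local Notation solid := (solid Omega).
Local Notation isometric_by := (isometric_by Omega).

Definition good s := solid s /\ irr Omega s.

Definition same_germ s t := spoly (s ++ t) !=set0 /\ rcone s = rcone t.

Lemma solid_interior s : solid s -> (poly s)° = spoly s.
Proof. by move=> [ws _]; rewrite interior_poly//; exact: walled_nondegenerate ws. Qed.

Lemma solid_sub s t : solid s -> solid t -> poly t `<=` poly s ->
  spoly t `<=` spoly s.
Proof.
move=> ss st ts; rewrite -!solid_interior//; exact: interiorS.
Qed.

Lemma irreducibleP P : irreducible Omega P <-> exists2 s, good s & P = poly s.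
Proof.
split=> [irrP|[s [ss irrs] ->]]; last exact: irr_irreducible.
have [P0|[s ss PE]] := polyhedralP irrP.1; last first.
  exists s => //; split=> //; apply: irreducible_irr => //; by rewrite -PE.
(* The empty set is not irreducible: its decomposition without members has no member of rank -1. *)
have [|Q [[[]]]] := irrP.2 set0.
by split; [exact: finite_set0| | |rewrite bigcup_set0 P0].
Qed.

Lemma commensurableP s t : solid s -> solid t ->
  commensurable (poly s) (poly t) <-> same_germ s t.
Proof.
move=> ss st; rewrite /commensurable /same_germ.
rewrite (ess_inter_poly ss.1 st.1).
by rewrite (eq_limit_set (solid_poly ss) (solid_poly st)).
Qed.

Lemma germ_poly s t : good s -> solid t ->
  germ (poly s) (poly t) <-> good t /\ same_germ s t.
Proof.
move=> [ss _] st; split=> [[_ irrt /(commensurableP ss st)]|[[_ irrt] sgt]].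
  by split=> //; split=> //; exact: irreducible_irr.
split; [exact: solid_poly st|exact: irr_irreducible|exact/commensurableP].
Qed.

Lemma germ_rep s Q : good s -> germ (poly s) Q ->
  exists2 t, good t /\ same_germ s t & Q = poly t.
Proof.
move=> gs gsQ; have [_ /irreducibleP[t [st irrt] QE] _] := gsQ.
by exists t => //; apply/germ_poly => //; rewrite -QE.
Qed.

Lemma same_germ_refl s : solid s -> same_germ s s.
Proof.
by move=> [_ [x sx]]; split=> //; exists x; apply/spoly_cat.
Qed.

Lemma same_germ_sym s t : same_germ s t -> same_germ t s.
Proof.
move=> [[x /spoly_cat[sx tx]] E]; split=> //.
by exists x; apply/spoly_cat.
Qed.

(** The source of smaller representatives: every full-rank polyhedral subset of an irreducible set
    represents the same germ. *)
Lemma good_sub s t : good s -> solid t -> poly t `<=` poly s ->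
  (forall a, perp t a -> perp s a) -> good t /\ same_germ s t.
Proof.
move=> [ss irrs] st ts perpts.
have E := irr_sub_rcone ss irrs st ts perpts.
split; first by split=> //; exact: irr_sub irrs ts E.
split=> //; have [x tx] := st.2; exists x; apply/spoly_cat; split=> //.
exact: solid_sub tx.
Qed.

Lemma good_cat s t : good s -> good t -> same_germ s t ->
  [/\ good (s ++ t), same_germ s (s ++ t) & same_germ t (s ++ t)].
Proof.
move=> gs gt [st0 E].
have solidst : solid (s ++ t).
  by split=> //; apply/walled_cat; split; [exact: gs.1.1|exact: gt.1.1].
have cE : rcone (s ++ t) = rcone s.
  apply/seteqP; split=> u; first by move=> /rcone_cat[].
  by move=> su; apply/rcone_cat; split=> //; rewrite -E.
have subs : poly (s ++ t) `<=` poly s by move=> x /poly_cat[].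
have subt : poly (s ++ t) `<=` poly t by move=> x /poly_cat[].
have perps a : perp (s ++ t) a -> perp s a by rewrite /perp cE.
have perpt a : perp (s ++ t) a -> perp t a by rewrite /perp cE E.
have [gst sst] := good_sub gs solidst subs perps.
by have [_ tst] := good_sub gt solidst subt perpt.
Qed.

(** The overlaps of [t] with [s] and with [q] might be far apart. A point of the first is pushed
    along the common cone until it satisfies the constraints of [q]. *)
Lemma same_germ_trans t s q : good s -> good t -> good q ->
  same_germ s t -> same_germ t q -> same_germ s q.
Proof.
move=> gs gt gq st tq; split; last by rewrite st.2 tq.2.
have [gts sts _] := good_cat gt gs (same_germ_sym st).
have [gtq stq _] := good_cat gt gq tq.
have wtq p : p \in t ++ q -> tail_nonneg t p.
  apply: (irr_tail_nonneg gt.2 gtq.1) => [x /poly_cat[]//|a].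
  by rewrite /perp -stq.2.
have subt : poly (t ++ s) `<=` poly t by move=> x /poly_cat[].
have [[x xtsq] _] := tail_nonneg_cat gtq.1.1 gts.1 subt (esym sts.2) wtq.
move: xtsq => /spoly_cat[/spoly_cat[_ sx] /spoly_cat[_ qx]].
by exists x; apply/spoly_cat.
Qed.

Lemma germ_eqP s t : good s -> good t ->
  germ (poly s) = germ (poly t) <-> same_germ s t.
Proof.
move=> gs gt; split=> [E|st].
  have : germ (poly s) (poly t).
    by rewrite E; apply/germ_poly => //; [exact: gt.1|split=> //; exact: same_germ_refl gt.1].
  by case/(germ_poly gs gt.1).
have sub (s' t' : seq (V * R)) : good s' -> good t' -> same_germ s' t' ->
    germ (poly s') `<=` germ (poly t').
  move=> gs' gt' st' Q /(germ_rep gs')[q [gq s'q] ->].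
  apply/germ_poly => //; first exact: gq.1.
  by split=> //; apply: same_germ_trans s'q => //; exact: same_germ_sym.
by apply/seteqP; split; apply: sub => //; exact: same_germ_sym.
Qed.

Lemma germsP (r : nat) gamma : germs Omega r gamma <->
  exists s, [/\ good s, rk (poly s) = r%:Z & gamma = germ (poly s)].
Proof.
split=> [[_ [/irreducibleP[s gs ->] rks] <-]|[s [gs rks ->]]]; first by exists s.
by exists (poly s) => //; split=> //; apply/irreducibleP; exists s.
Qed.

Lemma rk_same_germ s t : good s -> good t -> same_germ s t ->
  rk (poly s) = rk (poly t).
Proof.
move=> gs gt [_ E].
have [s0 t0] := (solid_poly gs.1, solid_poly gt.1).
have LE := (eq_limit_set s0 t0).2 E.
by apply/eqP; rewrite eq_le !rk_le// LE.
Qed.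

Lemma good_image g s : Isom g -> good s -> good (forms_image g s).
Proof. by move=> gI [ss irrs]; split; [exact: solid_image|exact: irr_image]. Qed.

Lemma rcone_imageE g s : Isom g ->
  rcone (forms_image g s) = [set u | rcone s (linear_part g^-1%g u)].
Proof.
move=> [gP _]; apply/seteqP; split=> u /=.
  by rewrite -{1}(linear_partKV u gP) => /rcone_image_iff; apply.
by rewrite -{2}(linear_partKV u gP) => su; apply/rcone_image_iff.
Qed.

Lemma same_germ_image g s t : Isom g -> same_germ s t ->
  same_germ (forms_image g s) (forms_image g t).
Proof.
move=> gI [[x /spoly_cat[sx tx]] E]; split; last by rewrite !rcone_imageE// E.
by exists (g x); apply/spoly_cat; split; apply/spoly_image_iff => //; exact: gI.1.
Qed.

Lemma germs_rk (r : nat) s : good s -> germs Omega r (germ (poly s)) ->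
  rk (poly s) = r%:Z.
Proof.
move=> gs /germsP[t [gt <- /(germ_eqP gs gt)]].
exact: rk_same_germ.
Qed.

Lemma germs_good s : good s -> exists r : nat,
  rk (poly s) = r%:Z /\ germs Omega r (germ (poly s)).
Proof.
move=> gs; have rkE : rk (poly s) = (`|rk (poly s)|%N)%:Z.
  by rewrite gez0_abs// rk_ge0//; exact: solid_poly gs.1.
by exists `|rk (poly s)|%N; split=> //; apply/germsP; exists s.
Qed.

Definition germ_move gamma g : set (set V) := [set g @` P | P in gamma].

Lemma germ_move1 gamma : germ_move gamma 1%g = gamma.
Proof.
apply/seteqP; split=> [_ [P gP <-]|P gP]; first by rewrite image_id.
by exists P => //; exact: image_id.
Qed.

Lemma germ_moveM gamma g h : germ_move (germ_move gamma g) h = germ_move gamma (g * h)%g.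
Proof.
by rewrite /germ_move image_comp; apply: eq_imagel => P _; rewrite image_bijM.
Qed.

Lemma germ_moveK gamma g : germ_move (germ_move gamma g) g^-1%g = gamma.
Proof. by rewrite germ_moveM mulgV germ_move1. Qed.

Lemma germ_move_poly g s : Isom g -> good s ->
  germ_move (germ (poly s)) g = germ (poly (forms_image g s)).
Proof.
have sub (h : bijection V) (t : seq (V * R)) : Isom h -> good t ->
    germ_move (germ (poly t)) h `<=` germ (poly (forms_image h t)).
  move=> hI gt _ [P /(germ_rep gt)[q [gq tq] ->] <-].
  rewrite poly_image; last exact: hI.1.
  apply/germ_poly; [exact: good_image|exact: (good_image hI gq).1|].
  by split; [exact: good_image|exact: same_germ_image].
move=> gI gs; apply/seteqP; split=> [|Q QP]; first exact: sub.
rewrite -(image_bijVK g^-1%g Q) invgK.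
exists (g^-1%g @` Q) => //.
have [gVI ggs] := (IsomV gI, good_image gI gs).
have := sub _ _ gVI ggs; rewrite -(poly_image _ gVI.1) -(poly_image _ gI.1).
by rewrite image_bijVK; apply; exists Q => //; rewrite (poly_image _ gI.1).
Qed.

Lemma germs_move r gamma g : Isom g -> germs Omega r gamma ->
  germs Omega r (germ_move gamma g).
Proof.
move=> gI /germsP[s [gs rks ->]]; apply/germsP; exists (forms_image g s).
split; [exact: good_image| |exact: germ_move_poly].
by rewrite rk_image//; [exact: gI.1|exact: solid_poly gs.1].
Qed.

Lemma isometric_by_sub f g P Q : P `<=` Q -> isometric_by f Q g -> isometric_by f P g.
Proof. by move=> PQ [gI fg]; split=> // x /(interiorS PQ); exact: fg. Qed.

(** Provides, for any decomposition, a member meeting [poly s] in full rank; applied to irreducible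
    [s] it yields a representative inside that member. *)
Lemma decomposition_refine D s : decomposition Omega D setT -> solid s ->
  exists t, [/\ D (poly t), solid (s ++ t) & forall a, perp (s ++ t) a -> perp s a].
Proof.
move=> dec ss; have [tt [ttD Dtt]] := decomposition_seq dec.
have ttnz t : t \in tt -> nondegenerate t.
  by move=> /ttD[[wt _] _]; exact: walled_nondegenerate wt.
have cov : covers (poly s) tt.
  move=> x _; have [_ _ _ DE] := dec.
  have [Q DQ Qx] : (\bigcup_(P in D) P) x by rewrite DE.
  by have [|t ttt QE] := Dtt Q DQ; [exists x|exists t => //; rewrite -QE].
have [t ttt [st0 perpst]] := covers_full_rank ss.2 ttnz cov.
have [[wt _] Dt] := ttD t ttt; exists t; split=> //; split=> //.
by apply/walled_cat; split=> //; exact: ss.1.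
Qed.

(** The value at [gamma] of the cocycle of [f]. It is a relation because a representative on which
    [f] is isometric has first to be found; values are unique since two representatives overlap in
    an open set. *)
Definition acts_by f gamma g := exists s,
  [/\ good s, gamma = germ (poly s) & isometric_by f (poly s) g].

Lemma acts_by_exists f s : piecewise_isometric Omega f -> good s ->
  exists g, acts_by f (germ (poly s)) g.
Proof.
move=> [D dec fD] gs; have [t [Dt st perpst]] := decomposition_refine dec gs.1.
have [g fg] := fD _ Dt; have [|gst sst] := good_sub gs st _ perpst; first by move=> x /poly_cat[].
exists g, (s ++ t); split=> //; first exact/germ_eqP.
by apply: isometric_by_sub fg => x /poly_cat[].
Qed.

Lemma acts_by_Isom f gamma g : acts_by f gamma g -> Isom g.
Proof. by move=> [s [_ _ []]]. Qed.

Lemma acts_by_unique f gamma g h : acts_by f gamma g -> acts_by f gamma h -> g = h.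
Proof.
move=> [s [gs -> [gI fg]]] [t [gt /(germ_eqP gs gt)[st0 _] [hI fh]]].
apply: (isometry_eq gI.1 hI.1 st0) => x /spoly_cat[sx tx].
by rewrite -fg ?fh// solid_interior//; [exact: gt.1|exact: gs.1].
Qed.

Lemma acts_by1 s : good s -> acts_by 1%g (germ (poly s)) 1%g.
Proof. by move=> gs; exists s; split=> //; split=> //; exact: Isom1. Qed.

(** The cocycle rule: the representative used for [h] is pulled back by [g] and intersected with the
    one used for [f]. *)
Lemma acts_byM f h gamma g k : acts_by f gamma g ->
  acts_by h (germ_move gamma g) k -> acts_by (f * h)%g gamma (g * k)%g.
Proof.
move=> [s [gs -> [gI fg]]] [t [gt]]; rewrite germ_move_poly// => E [kI hk].
have gVI := IsomV gI; have [gP _] := gI; have [gVP _] := gVI.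
have gt' := good_image gVI gt.
have : germ (poly s) = germ (poly (forms_image g^-1%g t)).
  by rewrite -germ_move_poly// -E -germ_move_poly// germ_moveK.
move=> /(germ_eqP gs gt') st'; have [gst' ss' _] := good_cat gs gt' st'.
exists (s ++ forms_image g^-1%g t); split=> //; first exact/germ_eqP.
split; first exact: IsomM.
move=> x; rewrite (solid_interior gst'.1) => /spoly_cat[sx t'x].
rewrite !bijME fg ?(solid_interior gs.1)// hk// (solid_interior gt.1).
by apply/(spoly_image_iff t (g x) gVP); rewrite bijVK.
Qed.

Lemma acts_byV f gamma g : acts_by f gamma g ->
  acts_by f^-1%g (germ_move gamma g) g^-1%g.
Proof.
move=> [s [gs -> [gI fg]]]; have ggs := good_image gI gs.
exists (forms_image g s); split=> //; first exact: germ_move_poly.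
split=> [|y]; first exact: IsomV.
rewrite (solid_interior ggs.1) -{1}(bijKV g y) => /(spoly_image_iff s _ gI.1).
rewrite -(solid_interior gs.1) => /fg E.
by rewrite -[in LHS](bijKV g y) -E bijVK.
Qed.

Lemma acts_by_rep f s t g : good s -> germ (poly s) (poly t) -> solid t ->
  isometric_by f (poly t) g -> acts_by f (germ (poly s)) g.
Proof.
move=> gs st solidt fg; have [gt sgt] := (germ_poly gs solidt).1 st.
by exists t; split=> //; exact/germ_eqP.
Qed.

Lemma germ_actE f gamma g : acts_by f gamma g ->
  germ_act Omega gamma f = germ_move gamma g.
Proof.
move=> fg; have [s [gs gE [gI fsg]]] := fg.
apply/seteqP; split=> [Q [P [h [gP fh hPQ]]]|].
  rewrite gE in gP; have [t [gt st] PE] := germ_rep gs gP.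
  rewrite {}PE in gP fh hPQ.
  have <- : h = g.
    by apply: acts_by_unique fg; rewrite gE; exact: acts_by_rep gP gt.1 fh.
  move: hPQ; rewrite poly_image; last by case: fh => -[].
  rewrite -germ_move_poly//; last by case: fh.
  by have := (germ_eqP gs gt).2 st => <-; rewrite -gE.
rewrite gE germ_move_poly// => Q sQ.
exists (poly s), g; split=> //; last by rewrite poly_image//; exact: gI.1.
apply/(germ_poly gs gs.1); split=> //; exact: same_germ_refl gs.1.
Qed.

End Germs.

(** * The group of piecewise isometries and its locally defined normal subgroups *)

Section PiecewiseIsometries.
Local Open Scope ring_scope.
Context {R : realType} {n : nat}.
Local Notation V := 'rV[R]_n.
Variable Omega : set (set V).
Implicit Types (f g h m : bijection V) (s t w : seq (V * R)) (p : V * R).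
Implicit Types (P Q : set V) (gamma : set (set V)) (x y u v a : V).
Local Notation Isom := (Isom Omega).
Local Notation solid := (solid Omega).
Local Notation isometric_by := (isometric_by Omega).
Local Notation piecewise_isometric := (piecewise_isometric Omega).
Local Notation PI := (PI Omega).

(** The pieces are cut out by preimages under the isometry chosen on [poly s], not under [f], which
    may differ from it on the boundary. Pieces without interior are discarded; the others still
    cover by [covers_thick]. *)
Lemma piecewise_isometricM f h :
  piecewise_isometric f -> piecewise_isometric h -> piecewise_isometric (f * h)%g.
Proof.
move=> [D decD fD] [E decE hE].
have exgf P : exists g, D P -> isometric_by f P g.
  have [/fD[g fg]|nDP] := pselect (D P); first by exists g.
  by exists 1%g.
have [gf gfP] := choice exgf.
have [ss [ssD Dss]] := decomposition_seq decD.
have [tt [ttE Ett]] := decomposition_seq decE.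
pose piece s t := s ++ forms_image (gf (poly s))^-1%g t.
pose ww := [seq w <- [seq piece s t | s <- ss, t <- tt] | `[< spoly w !=set0 >]].
have gI s : s \in ss -> Isom (gf (poly s)) by move=> /ssD[_ /gfP[]].
have spoly_piece s t x : s \in ss -> spoly (piece s t) x <->
    spoly s x /\ spoly t (gf (poly s) x).
  move=> sss; have [gVP _] := IsomV (gI s sss).
  rewrite /piece; have := spoly_image_iff t (gf (poly s) x) gVP.
  rewrite bijVK => -[H1 H2]; split=> [/spoly_cat[sx /H1]|[sx /H2 tx]] //.
  exact/spoly_cat.
have poly_piece s t x : s \in ss -> poly (piece s t) x <->
    poly s x /\ poly t (gf (poly s) x).
  move=> sss; have [gVP _] := IsomV (gI s sss).
  rewrite /piece; have := poly_image_iff t (gf (poly s) x) gVP.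
  rewrite bijVK => -[H1 H2]; split=> [/poly_cat[sx /H1]|[sx /H2 tx]] //.
  exact/poly_cat.
have walled_piece s t : s \in ss -> t \in tt -> walled Omega (piece s t).
  move=> sss /ttE[[wt _] _]; have [[ws _] _] := ssD s sss.
  by apply/walled_cat; split=> //; apply: walled_image => //; exact/IsomV/gI.
have wwP w : w \in ww -> solid w /\
    exists s t, [/\ s \in ss, t \in tt & w = piece s t].
  rewrite mem_filter => /andP[/asboolP w0 /allpairsP[[s t] /= [sss ttt wE]]].
  split; last by exists s, t.
  by split=> //; rewrite wE; exact: walled_piece.
exists [set poly w | w in [set` ww]]; last first.
  move=> _ [w /= /wwP[sw [s [t [sss ttt wE]]]] <-].
  have [sols Ds] := ssD s sss; have [solt Et] := ttE t ttt.
  have [k [kI hk]] := hE _ Et; have [gsI fg] := gfP _ Ds.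
  exists (gf (poly s) * k)%g; split; first exact: IsomM.
  move=> x; rewrite (solid_interior sw) wE => /(spoly_piece _ _ _ sss)[sx tx].
  by rewrite !bijME fg ?(solid_interior sols)// hk// (solid_interior solt).
split.
- by apply: finite_image; exact: finite_seq.
- by move=> _ [w /= /wwP[sw _] <-]; exact: polyhedral_poly.
- move=> _ Q [w /= /wwP[sw [s [t [sss ttt wE]]]] <-].
  move=> [w' /= /wwP[sw' [s' [t' [sss' ttt' wE']]]] <-] ww'.
  apply/ess_disjointP; rewrite ess_inter_poly; [|exact: sw.1|exact: sw'.1].
  move=> [x /spoly_cat[]]; rewrite wE wE'.
  move=> /(spoly_piece _ _ _ sss)[sx tx] /(spoly_piece _ _ _ sss')[sx' tx'].
  have [sols Ds] := ssD s sss; have [sols' Ds'] := ssD s' sss'.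
  have [solt Et] := ttE t ttt; have [solt' Et'] := ttE t' ttt'.
  (* A common interior point forces equal members of [D], and then its image forces equal members of
     [E]; overlapping pieces therefore coincide. *)
  have ss' : poly s = poly s'.
    apply: contrapT => ss'; have [_ _ /(_ _ _ Ds Ds' ss')/ess_disjointP + _] := decD.
    apply; apply/ess_inter_poly; [exact: sols.1|exact: sols'.1|].
    by exists x; apply/spoly_cat.
  have tt' : poly t = poly t'.
    apply: contrapT => tt'; have [_ _ /(_ _ _ Et Et' tt')/ess_disjointP + _] := decE.
    apply; apply/ess_inter_poly; [exact: solt.1|exact: solt'.1|].
    by exists (gf (poly s) x); apply/spoly_cat; split=> //; rewrite ss'.
  apply: ww'; rewrite wE wE'; apply/seteqP; split=> y.
    by move=> /(poly_piece _ _ _ sss)[sy ty]; apply/poly_piece; rewrite // -ss' -tt'.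
  by move=> /(poly_piece _ _ _ sss')[sy ty]; apply/poly_piece; rewrite // ss' tt'.
- apply/seteqP; split=> // x _.
  have [||w www wx] := @covers_thick _ _ [seq piece s t | s <- ss, t <- tt] _ _ x I.
  + move=> w /allpairsP[[s t] /= [sss ttt ->]].
    exact: walled_nondegenerate (walled_piece _ _ sss ttt).
  + move=> y _; have [_ _ _ DE] := decD; have [_ _ _ EE] := decE.
    have [P DP Py] : (\bigcup_(P in D) P) y by rewrite DE.
    have [|s sss PE] := Dss P DP; first by exists y.
    have [Q EQ Qy] : (\bigcup_(P in E) P) (gf (poly s) y) by rewrite EE.
    have [|t ttt QE] := Ett Q EQ; first by exists (gf (poly s) y).
    exists (piece s t); first by apply/allpairsP; exists (s, t).
    by apply/poly_piece => //; split; [rewrite -PE|rewrite -QE].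
  by exists (poly w) => //; exists w.
Qed.

Lemma piecewise_isometric1 : piecewise_isometric 1%g.
Proof.
have pT : poly [::] = [set: V] by apply/seteqP; split.
exists [set [set: V]]; last by move=> P _; exists 1%g; split=> //; exact: Isom1.
split; [exact: finite_set1| | |by rewrite bigcup_set1].
  move=> _ ->; rewrite -pT; apply: polyhedral_poly; split=> //.
  by exists 0.
by move=> P Q -> ->.
Qed.

Lemma PI1 : PI 1%g.
Proof. by split; rewrite ?invg1; exact: piecewise_isometric1. Qed.

Lemma PIV f : PI f -> PI f^-1%g.
Proof. by move=> [f1 f2]; split; rewrite ?invgK. Qed.

Lemma PIM f h : PI f -> PI h -> PI (f * h)%g.
Proof.
by move=> [f1 f2] [h1 h2]; split; rewrite ?invgM; exact: piecewise_isometricM.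
Qed.

Lemma subgroup_PI : subgroup PI.
Proof. by split=> [|x y Px Py]; [exact: PI1|apply: PIM => //; exact: PIV]. Qed.

Lemma PI_acts_by f gamma r : PI f -> germs Omega r gamma ->
  exists g, acts_by Omega f gamma g.
Proof. by move=> [fpi _] /germsP[s [gs _ ->]]; exact: acts_by_exists. Qed.

(* [G_ r], [C_ r] and [Cplus_ r] are of this form, with [B k] one of [r < k] and
   [r <= k]. *)
Definition local_group (B : nat -> Prop) (U : nat -> set (bijection V)) :=
  [set f | PI f /\ forall k gamma g, B k -> germs Omega k gamma ->
    acts_by Omega f gamma g -> germ_move gamma g = gamma /\ U k g].

Lemma local_group_normal B U : (forall k, U k 1%g) ->
    (forall k g h, Isom g -> Isom h -> U k g -> U k h -> U k (g * h)%g) ->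
    (forall k g, Isom g -> U k g -> U k g^-1%g) ->
    (forall k g m, Isom g -> Isom m -> U k g -> U k (m * (g * m^-1))%g) ->
  normal_subgroup (local_group B U) PI.
Proof.
move=> U1 UM UV UJ; split; last 2 first.
- by move=> f [].
- move=> f h [PIf fB] PIh; have PIVh := PIV PIh.
  split=> [|k gamma g Bk kg]; first exact/PIM/PIM.
  (* The conjugate applies [h^-1], then [f], then [h]: at [gamma] these act by [m], by some [a]
     fixing the moved germ, and by [m^-1]. *)
  have [m hm] := PI_acts_by PIVh kg.
  have mI := acts_by_Isom hm.
  have kgm := germs_move mI kg.
  have [a fa] := PI_acts_by PIf kgm.
  have [move_a Ua] := fB _ _ _ Bk kgm fa.
  have := acts_byV hm; rewrite invgK -[germ_move gamma m]move_a => hmV.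
  move=> /acts_by_unique/(_ (acts_byM hm (acts_byM fa hmV))) ->.
  rewrite -!germ_moveM move_a germ_moveK; split=> //.
  by apply: UJ => //; exact: acts_by_Isom fa.
split.
  split=> [|k gamma g _ /germsP[s [gs _ ->]]]; first exact: PI1.
  move=> /acts_by_unique/(_ (acts_by1 gs)) ->.
  by rewrite germ_move1.
move=> f h [PIf fB] [PIh hB]; split=> [|k gamma g Bk kg]; first exact/PIM/PIV.
have [a fa] := PI_acts_by PIf kg; have [move_a Ua] := fB _ _ _ Bk kg fa.
have [b hb] := PI_acts_by PIh kg; have [move_b Ub] := hB _ _ _ Bk kg hb.
have := acts_byV hb; rewrite move_b -[gamma in acts_by _ _ gamma]move_a => hbV.
move=> /acts_by_unique/(_ (acts_byM fa hbV)) ->.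
rewrite -germ_moveM move_a; split; first by rewrite -{1}move_b germ_moveK.
apply: UM => //; [exact: acts_by_Isom fa|exact: IsomV (acts_by_Isom hb)|].
by apply: UV => //; exact: acts_by_Isom hb.
Qed.

End PiecewiseIsometries.

(** * The subgroups of the chain as cocycle conditions *)

Section Chain.
Local Open Scope ring_scope.
Context {R : realType} {n : nat}.
Local Notation V := 'rV[R]_n.
Variable Omega : set (set V).
Hypotheses (fam : finitely_many_parallel_families Omega)
  (lfin : locally_finite_arrangement Omega)
  (hpd : Isom_properly_discontinuous Omega).
Implicit Types (f g h m : bijection V) (s t w : seq (V * R)) (p : V * R).
Implicit Types (P Q : set V) (gamma : set (set V)) (x y u v a : V) (k r : nat).
Local Notation Isom := (Isom Omega).
Local Notation solid := (solid Omega).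
Local Notation good := (good Omega).
Local Notation isometric_by := (isometric_by Omega).
Local Notation piecewise_isometric := (piecewise_isometric Omega).
Local Notation PI := (PI Omega).
Local Notation germs := (germs Omega).
Local Notation germ := (germ Omega).
Local Notation acts_by := (acts_by Omega).
Local Notation local_group := (local_group Omega).
Local Notation G_ := (G_ Omega).
Local Notation C_ := (C_ Omega).
Local Notation Cplus_ := (Cplus_ Omega).

Definition trivial_above r k : set (bijection V) := [set g | (r < k)%N -> g = 1%g].

Lemma good_piece s : solid s -> exists t,
  [/\ good t, poly t `<=` poly s & rk (poly t) = rk (poly s)].
Proof.
move=> ss; have [ts [tsP /(_ s ss)]] := finite_irreducible_pieces fam lfin ss.
by move=> [//|//|t /tsP[st irrt ts' rkt] _]; exists t.
Qed.

Lemma supp_isometry f s g : solid s -> poly s `<=` supp Omega f ->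
  isometric_by f (poly s) g -> g <> 1%g.
Proof.
move=> ss sf [gI fg] g1; have [x sx] := ss.2.
have [P [polP [h [[hI fh] h1]]] Px] := sf x (sub_spoly sx).
have [P0|[w sw PE]] := polyhedralP polP; first by rewrite P0 in Px.
rewrite {}PE in fh Px polP; have [y wy] := sw.2.
(* The point [x] may lie on the boundary of the set on which [f] acts by [h]; a small step towards
   its interior point [y] reaches both interiors. *)
have [r [sr wr]] := near_ex2 (spoly_near (y - x) sx) (spoly_segment Px wy).
apply/h1/(isometry_eq hI.1 (Isom1 Omega).1 (s := w ++ s)).
  by exists (x + r *: (y - x)); apply/spoly_cat.
move=> z /spoly_cat[wz sz].
by rewrite -g1 -fg ?fh// (solid_interior ss, solid_interior sw).
Qed.

(** A germ on which [f] acts nontrivially has a representative inside the support. Conversely, a set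
    in the support contains an irreducible one of its rank, on part of which [f] is a nontrivial
    isometry. *)
Lemma G_local r : G_ r = local_group (fun k => (r < k)%N) (trivial_above r).
Proof.
apply/seteqP; split=> f [PIf fr]; split=> //.
  move=> k gamma g rk kg fg; suff g1 : g = 1%g by rewrite g1 germ_move1.
  apply: contrapT => g1; have [s [gs gE fsg]] := fg; rewrite {}gE in kg.
  move: rk; rewrite ltnNge => /negP; apply; rewrite -lez_nat -(germs_rk gs kg).
  apply: le_trans fr; apply: (greatest_ge (b := n%:Z)); last first.
    by move=> _ [P _ <-]; exact: rk_leT.
  exists (poly s) => //; split; first exact: polyhedral_poly gs.1.
  move=> x sx; exists (poly s) => //; split; first exact: polyhedral_poly gs.1.
  by exists g.
rewrite /rk_map /greatest; case: xgetP => [j _ [[P [polP Pf] <-] _]|_]; last first.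
  (* Without a greatest element [greatest] takes its default value -1. *)
  by apply: (@le_trans _ _ (0 : int)).
have [->|[s ss PE]] := polyhedralP polP; first by rewrite rk_set0.
rewrite {}PE in Pf polP *.
have [t [gt ts <-]] := good_piece ss; have [k [tk kg]] := germs_good gt.
rewrite tk lez_nat leqNgt; apply/negP => rk.
have [D dec fD] := PIf.1; have [w [Dw stw perptw]] := decomposition_refine dec gt.1.
have [g fg] := fD _ Dw.
have subt : poly (t ++ w) `<=` poly t by move=> x /poly_cat[].
have ftwg : isometric_by f (poly (t ++ w)) g.
  by apply: isometric_by_sub fg => x /poly_cat[].
have [gtw same] := good_sub gt stw subt perptw.
have [|_ g1] := fr k _ g rk kg; first by exists (t ++ w); split=> //; exact/germ_eqP.
apply: (supp_isometry stw _ ftwg (g1 rk)).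
exact: subset_trans subt (subset_trans ts Pf).
Qed.

Lemma C_local r : C_ r = local_group (fun k => (r <= k)%N) (trivial_above r).
Proof.
rewrite /C_ G_local; apply/seteqP; split=> f.
  move=> [[PIf fr] fC]; split=> // k gamma g; rewrite leq_eqVlt => /predU1P[<-|rk].
    move=> rg fg; split; last by rewrite /trivial_above /= ltnn.
    by rewrite -(germ_actE fg) fC.
  by move=> kg fg; exact: fr fg.
move=> [PIf fr]; split; first by split=> // k gamma g /ltnW; exact: fr.
move=> gamma rg; have [g fg] := PI_acts_by PIf rg.
by rewrite (germ_actE fg); have [] := fr _ _ _ (leqnn r) rg fg.
Qed.

Lemma Cplus_local r : Cplus_ r = local_group (fun k => (r <= k)%N)
  (fun k => trivial_above r k `&` [set g | linear_part g = id]).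
Proof.
rewrite /Cplus_ C_local; apply/seteqP; split=> f.
  move=> [[PIf fr] fC]; split=> // k gamma g rk kg fg.
  have [mg g1] := fr _ _ _ rk kg fg; split=> //; split=> //.
  move: rk; rewrite leq_eqVlt => /predU1P[rk|/g1 -> /=]; last first.
    by apply/funext => v; rewrite /linear_part subr0.
  have [s [gs gE fsg]] := fg; apply: (fC gamma _ (poly s)) => //.
    by rewrite rk.
  by rewrite gE; apply/germ_poly => //; [exact: gs.1|split=> //; exact: same_germ_refl gs.1].
move=> [PIf fr]; split.
  by split=> // k gamma g rk kg fg; have [mg [g1 _]] := fr _ _ _ rk kg fg.
move=> gamma rg P g gP fPg; have /germsP[s [gs rks gE]] := rg.
rewrite gE in gP rg; have [t [gt st] PE] := germ_rep gs gP.
rewrite PE in gP fPg.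
by have [_ []] := fr _ _ _ (leqnn r) rg (acts_by_rep gs gP gt.1 fPg).
Qed.

Lemma linear_part_id1 : linear_part (1%g : bijection V) = id.
Proof. by apply/funext => v; rewrite /linear_part subr0. Qed.

Lemma linear_part_idM g h : Isom g -> Isom h -> linear_part g = id ->
  linear_part h = id -> linear_part (g * h)%g = id.
Proof.
move=> gI hI g1 h1; apply/funext => v.
by rewrite linear_partM ?g1 ?h1//; exact: hI.1.
Qed.

Lemma linear_part_idV g : Isom g -> linear_part g = id -> linear_part g^-1%g = id.
Proof.
move=> gI g1; apply/funext => v.
by have := linear_partVK v gI.1; rewrite g1.
Qed.

Lemma linear_part_idJ g m : Isom g -> Isom m -> linear_part g = id ->
  linear_part (m * (g * m^-1))%g = id.
Proof.
move=> gI mI g1; have [mVP _] := IsomV mI; apply/funext => v.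
rewrite linear_partM; last exact: (IsomM gI (IsomV mI)).1.
by rewrite linear_partM// g1 linear_partVK//; exact: mI.1.
Qed.

Lemma normal_G r : normal_subgroup (G_ r) PI.
Proof.
rewrite G_local; apply: local_group_normal => //.
- by move=> k g h _ _ g1 h1 rk; rewrite g1// h1// mulg1.
- by move=> k g _ g1 rk; rewrite g1// invg1.
- by move=> k g m _ _ g1 rk; rewrite g1// mul1g mulgV.
Qed.

Lemma normal_C r : normal_subgroup (C_ r) PI.
Proof.
rewrite C_local; apply: local_group_normal => //.
- by move=> k g h _ _ g1 h1 rk; rewrite g1// h1// mulg1.
- by move=> k g _ g1 rk; rewrite g1// invg1.
- by move=> k g m _ _ g1 rk; rewrite g1// mul1g mulgV.
Qed.

Lemma normal_Cplus r : normal_subgroup (Cplus_ r) PI.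
Proof.
rewrite Cplus_local; apply: local_group_normal => //.
- by move=> k; split=> //=; exact: linear_part_id1.
- move=> k g h gI hI [g1 gl] [h1 hl]; split; last exact: linear_part_idM.
  by move=> rk; rewrite g1// h1// mulg1.
- move=> k g gI [g1 gl]; split; last exact: linear_part_idV.
  by move=> rk; rewrite g1// invg1.
- move=> k g m gI mI [g1 gl]; split; last exact: linear_part_idJ.
  by move=> rk; rewrite g1// mul1g mulgV.
Qed.

Lemma G_pred_sub_Cplus r : (0 < r)%N -> G_ r.-1 `<=` Cplus_ r.
Proof.
move=> r0; rewrite G_local Cplus_local => f [PIf fr]; split=> // k gamma g.
rewrite -{1}(prednK r0) => rk kg fg; have [mg /(_ rk) g1] := fr _ _ _ rk kg fg.
by split=> //; rewrite g1; split=> //; exact: linear_part_id1.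
Qed.

Lemma G_top : G_ n = PI.
Proof.
rewrite G_local; apply/seteqP; split=> f; first by case.
move=> PIf; split=> // k gamma g nk /germsP[s [_ sk _]].
by have := rk_leT (poly s); rewrite sk lez_nat leqNgt nk.
Qed.

(** * The bottom of the chain *)

Section TrivialGroup.

Lemma rank0_perp s a : poly s !=set0 -> rk (poly s) = 0 -> perp s a.
Proof.
move=> s0 rk0; apply/(perp_limit_set a s0) => u su.
have [k [M [rkE _ _ /(_ u su)]]] := rkP s0.
move: rkE; rewrite rk0 => -[k0]; move: M; rewrite -k0 => M /submxP[D ->].
by rewrite [M]flatmx0 mulmx0 dot0r.
Qed.

(** In rank 0 every form annihilates the cone, so [irr] says that no wall properly cuts [poly s];
    one common interior point then puts it inside [poly t]. *)
Lemma rank0_same_germ s t : good s -> good t -> same_germ s t ->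
  rk (poly s) = 0 -> poly s `<=` poly t.
Proof.
move=> gs gt [[y /spoly_cat[sy ty]] _] rk0 x sx p pt.
rewrite leNgt; apply/negP => px; have [||_] := gs.2 p (gt.1.1 p pt).
- by exists x.
- by exists y; [exact: sub_spoly|exact: ty].
by apply; exact: rank0_perp (solid_poly gs.1) rk0.
Qed.

Lemma slope_ge0_nat (a b : R) : (forall j : nat, 0 <= a + j%:R * b) -> 0 <= b.
Proof.
move=> ab; rewrite leNgt; apply/negP => b0.
have := archi_boundP (normr_ge0 (a / b)).
set j := Num.bound _; have := ab j; move=> abj.
rewrite ltNge => /negP; apply; rewrite normrM normfV (ltr0_norm b0).
rewrite ler_pdivlMr ?oppr_gt0// (le_trans _ (ler_norm _))//.
by lra.
Qed.

(** A translation fixing the germ maps [poly s] into itself; its iterates show that the translation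
    vector lies in the recession cone, which is zero in rank 0. *)
Lemma rank0_translation s g : good s -> Isom g -> rk (poly s) = 0 ->
  germ_move (germ (poly s)) g = germ (poly s) -> linear_part g = id -> g = 1%g.
Proof.
move=> gs gI rk0; rewrite germ_move_poly// => sg g1.
have ggs := good_image gI gs; have same := (germ_eqP ggs gs).1 sg.
have stab x : poly s x -> poly s (x + g 0).
  move=> sx; have <- : g x = x + g 0 by rewrite (isometryE g x) g1.
  apply: (rank0_same_germ ggs gs same).
    by rewrite rk_image//; [exact: gI.1|exact: solid_poly gs.1].
  by apply/poly_image_iff => //; exact: gI.1.
have [x sx] := solid_poly gs.1.
have stabn j : poly s (x + j%:R *: g 0).
  elim: j => [|j IH]; first by rewrite scale0r addr0.
  by rewrite -natr1 scalerDl scale1r addrA; exact: stab.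
have rg : rcone s (g 0).
  move=> p ps; apply: (@slope_ge0_nat (slack p x)) => j.
  by rewrite -slackD; exact: stabn.
have g0 : g 0 = 0.
  by apply/eqP; rewrite -dot_eq0 (rank0_perp (g 0) (solid_poly gs.1) rk0).
by apply: bijP => y; rewrite isometryE g1 g0 addr0.
Qed.

Lemma PI_trivial_Cplus0 : PI_trivial Omega = Cplus_ 0.
Proof.
rewrite Cplus_local; apply/seteqP; split=> f [PIf].
  move=> [D dec f1]; split=> // k gamma g _ _ [s [gs _ [gI fg]]].
  suff -> : g = 1%g.
    by rewrite germ_move1; split=> //; split=> //; exact: linear_part_id1.
  have [t [Dt st _]] := decomposition_refine dec gs.1.
  apply: (isometry_eq gI.1 (Isom1 Omega).1 st.2) => x stx.
  have sub (A : set V) : poly (s ++ t) `<=` A -> A° x.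
    by move=> stA; apply: (interiorS stA); rewrite (solid_interior st).
  by rewrite -fg ?(f1 _ Dt)//; apply: sub => y /poly_cat[].
move=> fr; split=> //; have [D dec fD] := PIf.1; exists D => // P DP.
have [g [gI fg]] := fD P DP; have [_ polD _ _] := dec.
have [->|[s ss PE]] := polyhedralP (polD _ DP); first by rewrite interior0.
rewrite {}PE in fg *; have [t [gt ts _]] := good_piece ss; have [k [tk kg]] := germs_good gt.
have ftg : isometric_by f (poly t) g by apply: isometric_by_sub ts _.
have [|mg [g1 gl]] := fr k _ g (leq0n k) kg; first by exists t.
suff gE : g = 1%g by move=> x Px; rewrite fg ?gE.
(* The germ found inside the member has some rank [k]: for [k > 0] triviality is part of the
   condition, for [k = 0] only translations remain. *)
case: k tk {kg} g1 => [t0 _|k _ ->//].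
exact: (rank0_translation gt gI t0 mg gl).
Qed.

End TrivialGroup.

End Chain.

(** * Cosets and generated subgroups *)

Section Cosets.
Local Open Scope group_scope.
Context {gT : groupType}.
Implicit Types (N M S : set gT) (x y : gT).

Lemma subgroup1 N : subgroup N -> N 1.
Proof. by case. Qed.

Lemma subgroupV N x : subgroup N -> N x -> N x^-1.
Proof. by move=> [N1 Nd] Nx; rewrite -(mul1g x^-1); exact: Nd. Qed.

Lemma subgroupM N x y : subgroup N -> N x -> N y -> N (x * y).
Proof.
move=> sN Nx Ny; rewrite -(invgK y); apply: (sN.2) => //.
exact: subgroupV.
Qed.

Lemma coset_by_eq N x y : subgroup N -> N (x^-1 * y) -> coset_by N x = coset_by N y.
Proof.
move=> sN Nxy; apply/seteqP; split=> _ [z Nz <-].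
  exists ((x^-1 * y)^-1 * z); first by apply: subgroupM => //; exact: subgroupV.
  by rewrite invgM invgK -!mulgA mulVKg.
exists (x^-1 * y * z); first exact: subgroupM.
by rewrite -mulgA mulVKg.
Qed.

Lemma generated_sub S M : subgroup M -> S `<=` M -> generated_subgroup S `<=` M.
Proof. by move=> sM SM x; apply. Qed.

Lemma subgroup_generated S : subgroup (generated_subgroup S).
Proof.
split=> [M [sM _]|x y Sx Sy M MS]; first exact: subgroup1.
by apply: (MS.1.2); [exact: Sx|exact: Sy].
Qed.

End Cosets.

(** * Local finiteness and commutativity of the quotients *)

Section Quotients.
Local Open Scope ring_scope.
Context {R : realType} {n : nat}.
Local Notation V := 'rV[R]_n.
Variable Omega : set (set V).
Hypotheses (fam : finitely_many_parallel_families Omega)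
  (lfin : locally_finite_arrangement Omega)
  (hpd : Isom_properly_discontinuous Omega).
Implicit Types (f g h m : bijection V) (s t w : seq (V * R)) (p : V * R).
Implicit Types (P Q : set V) (gamma : set (set V)) (k r : nat).
Implicit Types (S N : set (bijection V)).
Local Notation Isom := (Isom Omega).
Local Notation solid := (solid Omega).
Local Notation good := (good Omega).
Local Notation isometric_by := (isometric_by Omega).
Local Notation PI := (PI Omega).
Local Notation germs := (germs Omega).
Local Notation germ := (germ Omega).
Local Notation acts_by := (acts_by Omega).
Local Notation G_ := (G_ Omega).
Local Notation C_ := (C_ Omega).
Local Notation Cplus_ := (Cplus_ Omega).

Definition moved_germs r f : set (set (set V)) :=
  [set gamma | germs r gamma /\ exists2 g, acts_by f gamma g & g <> 1%g].

Lemma finite_moved_germs r f : G_ r f -> finite_set (moved_germs r f).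
Proof.
rewrite G_local// => -[PIf fr]; have [D dec fD] := PIf.1.
have [ss [ssD Dss]] := decomposition_seq dec.
have exts s : exists ts : seq (seq (V * R)), solid s ->
    (forall t, t \in ts -> [/\ solid t, irr Omega t, poly t `<=` poly s &
      rk (poly t) = rk (poly s)]) /\
    (forall q, solid q -> poly q `<=` poly s -> (forall a, perp q a -> perp s a) ->
      exists2 t, t \in ts & spoly (q ++ t) !=set0 /\
        forall a, perp (q ++ t) a -> perp s a).
  have [/(finite_irreducible_pieces fam lfin)[ts tsP]|ns] := pselect (solid s).
    by exists ts.
  by exists [::].
have [ts tsP] := choice exts.
have fin : finite_set [set germ (poly t) | t in [set` flatten (map ts ss)]].
  by apply: finite_image; exact: finite_seq.
apply: sub_finite_set fin => gamma [rg [g fg g1]].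
have /germsP[q [gq rkq gE]] := rg; rewrite {}gE in rg fg *.
have [w [Dw sqw perpqw]] := decomposition_refine dec gq.1.
have [x /spoly_cat[qx wx]] := sqw.2.
have [|s sss ws] := Dss _ Dw; first by exists x; exact: sub_spoly.
have [sols Ds] := ssD s sss; have [tsP1 tsP2] := tsP s sols.
have [h fh] := fD _ Ds.
have subq : poly (q ++ w) `<=` poly q by move=> y /poly_cat[].
have subs : poly (q ++ w) `<=` poly s by rewrite -ws => y /poly_cat[].
have [gqw same] := good_sub gq sqw subq perpqw.
have hg : h = g.
  apply: acts_by_unique fg; exists (q ++ w); split=> //; first exact/germ_eqP.
  exact: isometric_by_sub fh.
have qw0 := solid_poly sqw.
(* A member of larger rank would contain a germ of rank above [r] on which [f] acts by the same
   nontrivial isometry, contrary to the description of [G_ r]. *)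
have rks : rk (poly s) = r%:Z.
  apply/eqP; rewrite eq_le; apply/andP; split; last first.
    by rewrite -rkq (rk_same_germ gq gqw same); exact: rk_poly_le.
  have [t [gt ts' <-]] := good_piece fam lfin sols; have [k [tk kg]] := germs_good gt.
  rewrite tk lez_nat leqNgt; apply/negP => rk.
  have [|_ /(_ rk)] := fr k _ h rk kg; last by rewrite hg.
  by exists t; split=> //; exact: isometric_by_sub fh.
have perpqs a : perp (q ++ w) a -> perp s a.
  have [perpP _] := rk_poly_eqP qw0 subs; apply: perpP.
  by rewrite rks -rkq (rk_same_germ gq gqw same).
(* The representative inside the member meets a listed piece [t] in full rank, and the intersection
   represents the germs of both. *)
have [t tts [qwt0 perpt]] := tsP2 _ sqw subs perpqs.
have [solt irrt tsub rkt] := tsP1 t tts.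
have solqwt : solid ((q ++ w) ++ t).
  by split=> //; apply/walled_cat; split; [exact: sqw.1|exact: solt.1].
have sub1 : poly ((q ++ w) ++ t) `<=` poly (q ++ w) by move=> y /poly_cat[].
have sub2 : poly ((q ++ w) ++ t) `<=` poly t by move=> y /poly_cat[].
have perp1 a : perp ((q ++ w) ++ t) a -> perp (q ++ w) a.
  by move=> /perpt pa u qwu; apply/pa/(sub_rcone qw0 subs).
have perp2 a : perp ((q ++ w) ++ t) a -> perp t a.
  by move=> /perpt pa u tu; apply/pa/(sub_rcone (solid_poly solt) tsub).
have gt : good t by [].
have [gqwt same1] := good_sub gqw solqwt sub1 perp1.
have [_ same2] := good_sub gt solqwt sub2 perp2.
exists t; first by apply/flattenP; exists (ts s) => //; exact: map_f.
apply/germ_eqP => //; apply: (same_germ_trans gt gqwt gq same2).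
by apply: same_germ_sym; exact: same_germ_trans gq gqw gqwt same same1.
Qed.

(** Expresses the value of [f^-1 * h] through the values of [f] and [h] at one and the same germ,
    where their labels can be compared. *)
Lemma acts_by_left_quotient f h gamma m : PI f -> PI h -> acts_by f^-1%g gamma m ->
  acts_by f (germ_move gamma m) m^-1%g /\
  forall b, acts_by h (germ_move gamma m) b -> acts_by (f^-1 * h)%g gamma (m * b)%g.
Proof.
move=> PIf PIh fm; split; last by move=> b; exact: acts_byM.
by have := acts_byV fm; rewrite invgK.
Qed.

(* An element of <S> is determined modulo N by its labels at the finitely many
   germs that some member of S moves. *)
Lemma locally_finite_by_labels r (T : choiceType)
    (label : set (set V) -> bijection V -> T) (N A : set (bijection V)) :
    subgroup A -> subgroup N -> A `<=` G_ r ->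
    (forall S, finite_set S -> S `<=` A -> forall M : set (set (set V)),
      finite_set M ->
      (forall f gamma g, generated_subgroup S f -> germs r gamma -> ~ M gamma ->
        acts_by f gamma g -> g = 1%g) ->
      exists2 X : set T, finite_set X & forall f gamma g, generated_subgroup S f ->
        germs r gamma -> M gamma -> acts_by f gamma g -> X (label gamma g)) ->
    (forall f h, A f -> A h -> (forall gamma g g', germs r gamma ->
        acts_by f gamma g -> acts_by h gamma g' -> label gamma g = label gamma g') ->
      N (f^-1 * h)%g) ->
  locally_finite_quotient A N.
Proof.
move=> sA sN AG labX labN S finS SA.
pose M := \bigcup_(f in S) moved_germs r f.
have finM : finite_set M.
  by apply: bigcup_finite => // f /SA/AG; exact: finite_moved_germs.
have PIA f : A f -> PI f by move=> /AG[].
(* The members of [S] act trivially off [M]; as this defines a subgroup, so do all elements they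
   generate. *)
pose fixM := [set f | A f /\ forall gamma g, germs r gamma -> ~ M gamma ->
  acts_by f gamma g -> g = 1%g].
have sfix : subgroup fixM.
  split.
    split=> [|gamma g /germsP[s [gs _ ->]] _]; first exact: subgroup1.
    by move=> /acts_by_unique; apply; exact: acts_by1.
  move=> f h [Af fM] [Ah hM]; split=> [|gamma g rg nM]; first exact: sA.2.
  have [a fa] := PI_acts_by (PIA _ Af) rg; have [b hb] := PI_acts_by (PIA _ Ah) rg.
  have a1 := fM _ _ rg nM fa; have b1 := hM _ _ rg nM hb.
  rewrite {}a1 in fa; rewrite {}b1 in hb.
  have := acts_byV hb; rewrite germ_move1 invg1 => hbV.
  move=> /acts_by_unique; apply; rewrite -(mulg1 1%g).
  by apply: acts_byM fa _; rewrite germ_move1.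
have SfixM : S `<=` fixM.
  move=> f Sf; split=> [|gamma g rg nM fg]; first exact: SA.
  by apply: contrapT => g1; apply: nM; exists f => //; split=> //; exists g.
have genfix := generated_sub sfix SfixM.
have [|X finX XP] := labX S finS SA M finM.
  by move=> f gamma g /genfix[_]; apply.
(* The graph of the labels on [M], one of finitely many subsets of the product of [M] and [X]. Off
   [M] labels agree because both elements act trivially. *)
pose F f : set (set (set V) * T) := [set z | exists gamma g,
  [/\ germs r gamma, M gamma, acts_by f gamma g & z = (gamma, label gamma g)]].
apply: (finite_image_factor (F := F)).
  have : finite_set (M `*` X) by exact: finite_setX.
  move=> /finite_powerset; apply: sub_finite_set => _ [f Sf <-].
  by move=> _ [gamma [g [rg Mg fg ->]]]; split=> //; exact: XP fg.
move=> f h Sf Sh FE; have [Af fM] := genfix f Sf; have [Ah hM] := genfix h Sh.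
apply: coset_by_eq => //; apply: labN => // gamma g g' rg fg hg'.
have [Mg|nMg] := pselect (M gamma); last by rewrite (fM _ _ rg nMg fg) (hM _ _ rg nMg hg').
have : F h (gamma, label gamma g) by rewrite -FE; exists gamma, g.
move=> [gamma2 [g2 [_ _ hg2 [E ->]]]]; rewrite -{}E in hg2 *.
by rewrite (acts_by_unique hg' hg2).
Qed.

Lemma G_C_locally_finite r : locally_finite_quotient (G_ r) (C_ r).
Proof.
have GL := G_local fam lfin r.
have [sG _ _] := normal_G fam lfin r; have [sC _ _] := normal_C fam lfin r.
apply: (locally_finite_by_labels (r := r) (label := @germ_move R n)) => //.
  (* The label is the image germ, which stays in [M]: were it outside, [f^-1] would act trivially
     there, so that [gamma] would equal its image. *)
  move=> S finS SA M finM nM; exists M => // f gamma g Sf rg Mg fg.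
  apply: contrapT => nMg; apply: (nMg).
  have SfV := subgroupV (subgroup_generated S) Sf.
  have := nM _ _ _ SfV (germs_move (acts_by_Isom fg) rg) nMg (acts_byV fg).
  by move=> g1; rewrite -(invgK g) g1 invg1 germ_move1.
move=> f h Gf Gh lab; rewrite C_local//; rewrite GL in Gf Gh.
have [PIf fr] := Gf; have [PIh hr] := Gh.
split=> [|k gamma g rk kg fhg]; first by apply: PIM => //; exact: PIV.
have [m fm] := PI_acts_by (PIV PIf) kg.
have [fmV hb] := acts_by_left_quotient PIf PIh fm.
have kgm := germs_move (acts_by_Isom fm) kg.
have [b hmb] := PI_acts_by PIh kgm.
rewrite (acts_by_unique fhg (hb _ hmb)) -germ_moveM.
move: rk; rewrite leq_eqVlt => /predU1P[rk|rk].
  rewrite -rk in kgm *; rewrite /trivial_above /= ltnn; split=> //.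
  by rewrite -(lab _ _ _ kgm fmV hmb) germ_moveK.
have [_ /(_ rk) mV1] := fr _ _ _ rk kgm fmV.
have [_ /(_ rk) b1] := hr _ _ _ rk kgm hmb.
have m1 : m = 1%g by rewrite -(invgK m) mV1 invg1.
by rewrite m1 b1 !germ_move1 mulg1.
Qed.

(** The labels are linear parts, finitely many by [finite_linear_parts]; if those of [f] and [h]
    agree at a germ of rank [r], then [f^-1 * h] acts there by a translation. *)
Lemma C_Cplus_locally_finite r : locally_finite_quotient (C_ r) (Cplus_ r).
Proof.
have CL := C_local fam lfin r.
have [sC _ _] := normal_C fam lfin r; have [sC' _ _] := normal_Cplus fam lfin r.
apply: (locally_finite_by_labels (r := r) (label := fun _ => @linear_part R n)) => //.
- by move=> f [].
- move=> S finS SA M finM nM; exists [set linear_part g | g in Isom].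
    exact: finite_linear_parts.
  by move=> f gamma g _ _ _ /acts_by_Isom gI; exists g.
move=> f h Cf Ch lab; rewrite Cplus_local//; rewrite CL in Cf Ch.
have [PIf fr] := Cf; have [PIh hr] := Ch.
split=> [|k gamma g rk kg fhg]; first by apply: PIM => //; exact: PIV.
have [m fm] := PI_acts_by (PIV PIf) kg.
have [fmV hb] := acts_by_left_quotient PIf PIh fm.
have mI := acts_by_Isom fm; have kgm := germs_move mI kg.
have [b hmb] := PI_acts_by PIh kgm; have bI := acts_by_Isom hmb.
have [mV_move mV1] := fr _ _ _ rk kgm fmV.
have [b_move b1] := hr _ _ _ rk kgm hmb.
rewrite (acts_by_unique fhg (hb _ hmb)) -germ_moveM b_move.
split; first by rewrite -[in LHS]mV_move germ_moveM mulgV germ_move1.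
split=> /=.
  move=> rk'; rewrite (b1 rk') -(invgK m) (mV1 rk').
  by rewrite invg1 mulg1.
move: rk; rewrite leq_eqVlt => /predU1P[rk|rk].
  rewrite -rk in kgm *; apply/funext => v.
  rewrite linear_partM; last exact: bI.1.
  by rewrite -(lab _ _ _ kgm fmV hmb) linear_partVK//; exact: mI.1.
by rewrite (b1 rk) -(invgK m) (mV1 rk) invg1 mulg1 linear_part_id1.
Qed.

Lemma translations_commute g h : Isom g -> Isom h -> linear_part g = id ->
  linear_part h = id -> (g * h)%g = (h * g)%g.
Proof.
move=> [gP _] [hP _] g1 h1; apply: bijP => x; rewrite !bijME.
rewrite (isometryE h (g x)) (isometryE g x) (isometryE g (h x)) (isometryE h x).
by rewrite g1 h1 addrAC.
Qed.

(** At each germ of rank at least [r] both elements act by translations fixing the germ, trivial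
    ones above rank [r]; the quotient of the two products acts there by a commutator of
    translations. *)
Lemma Cplus_G_abelian r : (0 < r)%N -> abelian_quotient (Cplus_ r) (G_ r.-1).
Proof.
move=> r0; have [sG _ _] := normal_G fam lfin r.-1.
rewrite Cplus_local// => f h [PIf fr] [PIh hr]; apply: coset_by_eq => //.
have PIfh := PIM PIf PIh; have PIhf := PIM PIh PIf.
rewrite G_local//; split=> [|k gamma g]; first by apply: PIM => //; exact: PIV.
rewrite (prednK r0) => rk kg fhg; suff g1 : g = 1%g by rewrite g1 germ_move1.
have [a fa] := PI_acts_by PIf kg; have [a_move [_ a1]] := fr _ _ _ rk kg fa.
have [b hb] := PI_acts_by PIh kg; have [b_move [_ b1]] := hr _ _ _ rk kg hb.
have fh : acts_by (f * h)%g gamma (a * b)%g by apply: acts_byM fa _; rewrite a_move.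
have hf : acts_by (h * f)%g gamma (b * a)%g by apply: acts_byM hb _; rewrite b_move.
have ab_move : germ_move gamma (a * b)%g = gamma by rewrite -germ_moveM a_move b_move.
have := acts_byV fh; rewrite ab_move => fhV.
have := acts_byM fhV (_ : acts_by (h * f)%g (germ_move gamma (a * b)^-1%g) (b * a)%g).
have -> : germ_move gamma (a * b)^-1%g = gamma by rewrite -{1}ab_move germ_moveK.
move=> /(_ hf)/(acts_by_unique fhg) ->.
rewrite (translations_commute (acts_by_Isom hb) (acts_by_Isom fa) b1 a1).
by rewrite mulVg.
Qed.

End Quotients.

Theorem proposition1p2 (R : realType) (n : nat) (Omega : set (set 'rV[R]_n))
    (hfam : finitely_many_parallel_families Omega)
    (htess : locally_finite_arrangement Omega)
    (hpd : Isom_properly_discontinuous Omega)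
    (hcoc : Isom_cocompact Omega)
    (horb : Isom_finitely_many_orbits Omega) :
  (subgroup (PI Omega) /\
   forall r : nat, (r <= n)%N ->
     [/\ normal_subgroup (Cplus_ Omega r) (PI Omega),
         normal_subgroup (C_ Omega r) (PI Omega) &
         normal_subgroup (G_ Omega r) (PI Omega)]) /\
  [/\ PI_trivial Omega = Cplus_ Omega 0,
      forall r : nat, (r <= n)%N ->
        Cplus_ Omega r `<=` C_ Omega r /\ C_ Omega r `<=` G_ Omega r,
      forall r : nat, (0 < r <= n)%N -> G_ Omega r.-1 `<=` Cplus_ Omega r &
      G_ Omega n = PI Omega] /\
  [/\ forall r : nat, (r <= n)%N ->
        locally_finite_quotient (G_ Omega r) (C_ Omega r),
      forall r : nat, (r <= n)%N ->
        locally_finite_quotient (C_ Omega r) (Cplus_ Omega r) &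
      forall r : nat, (0 < r <= n)%N ->
        abelian_quotient (Cplus_ Omega r) (G_ Omega r.-1)].
Proof.
split; [split; first exact: subgroup_PI|split; split].
- by move=> r _; split; [exact: normal_Cplus|exact: normal_C|exact: normal_G].
- exact: PI_trivial_Cplus0.
- by move=> r _; split=> f [].
- by move=> r /andP[r0 _]; exact: G_pred_sub_Cplus.
- exact: G_top.
- by move=> r _; exact: G_C_locally_finite.
- by move=> r _; exact: C_Cplus_locally_finite.
- by move=> r /andP[r0 _]; exact: Cplus_G_abelian.
Qed.
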